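(* Let $a\in(0,1)$ be a real number and let $r\ge 2$ be a positive integer. For $y\in[0,1]$ let $(a_n(y))_{n\in\mathbb{N}}$ be the sequence obtained by arranging the set $$\left\{n\in\mathbb{N}:\ r^n y \bmod 1\in (0,n^{-a})\right\}$$ in increasing order. Then, for $\lambda$-almost every $y\in[0,1]$, the sequence $(a_n(y))_{n\in\mathbb{N}}$ is pointwise $L^2$-good.
   Context: $\lambda$ denotes Lebesgue measure on $[0,1]$. A measure preserving system (m.p.s.) is a tuple $(X,\mathcal{X},\mu,T)$ where $(X,\mathcal{X},\mu)$ is a probability space and $T\colon X\to X$ is $\mathcal{X}$-measurable with $\mu(T^{-1}A)=\mu(A)$ for all $A\in\mathcal{X}$. For $p\ge 1$, a sequence of integers $(a_n)_{n\in\mathbb{N}}$ is pointwise $L^p$-good if for every m.p.s. $(X,\mathcal{X},\mu,T)$ and every $f\in L^p(\mu)$, the averages $\frac1N\sum_{n=1}^N f(T^{a_n}x)$ converge as $N\to\infty$ for $\mu$-almost every $x\in X$. (For $\lambda$-almost every $y$ the set above is infinite, so the sequence is well defined.) *)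

(* Defs.v *)
From HB Require Import structures.
From mathcomp Require Import all_boot all_order all_algebra.
From mathcomp Require Import all_classical all_reals all_analysis.

Set Implicit Arguments.
Unset Strict Implicit.
Unset Printing Implicit Defensive.

Import Order.TTheory GRing.Theory Num.Theory.
Import numFieldNormedType.Exports.

Local Open Scope classical_set_scope.
Local Open Scope ring_scope.

Definition measure_preserving d (X : measurableType d) (R : realType)
    (mu : probability X R) (T : X -> X) : Prop :=
  measurable_fun setT T /\
  (forall A : set X, measurable A -> mu (T @^-1` A) = mu A).

(* Sequences are indexed from 0: [s n] is the (n+1)-st term, so the sum below
   runs over the first N terms.  The terms are natural numbers because [T] is
   not assumed invertible. *)
Definition ergodic_average (X : Type) (R : realType) (s : nat -> nat)
    (T : X -> X) (f : X -> R) (N : nat) (x : X) : R :=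
  N%:R^-1 * \sum_(n < N) f (iter (s n) T x).

(* Intended for 1 <= p. *)
Definition pointwise_good (R : realType) (p : R) (s : nat -> nat) : Prop :=
  forall (d : measure_display) (X : measurableType d) (mu : probability X R)
    (T : X -> X), measure_preserving mu T ->
  forall f : X -> R, f \in Lfun mu p%:E ->
  {ae mu, forall x, cvgn (fun N => ergodic_average s T f N x)}.

Definition frac_part (R : realType) (x : R) : R := x - (Num.floor x)%:~R.

Definition hitting_times (R : realType) (a : R) (r : nat) (y : R) : set nat :=
  [set n | (0 < n)%N /\ 0 < frac_part (r%:R ^+ n * y) < n%:R `^ (- a)].

(* Such an [s] exists exactly when [A] is infinite, and is then unique. *)
Definition increasing_enumeration (A : set nat) (s : nat -> nat) : Prop :=
  {homo s : m n / (m < n)%N} /\ range s = A.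

(* Main.v *)
(** Let [X_n(y)] indicate that [n] is a hitting time and [w_n = n ^ (-a)].
    Whether [n] hits depends, up to a rare event, on the [k] digits of [y] in
    base [r] after position [n], so within a residue class modulo [k] the
    [X_n] behave as independent variables of mean [w_n].  A Chernoff bound and
    Borel-Cantelli along [N = k ^ q] give, for almost every [y],
    [|sum_(n <= N) (X_n - w_n) z ^ n| = O(k^-1 sum_(n <= N) w_n)] uniformly over
    the [2N]-th roots of unity [z].  By transference and Parseval this bounds
    the [L^2] operator norm of the averages of [f \o T ^ n] with weights
    [X_n - w_n]; the bounds are square summable in [k], so these averages tend
    to [0] almost everywhere.  The averages with the smooth weights [w_n]
    converge by Birkhoff's theorem and summation by parts.  Finally, for
    [f >= 0] monotonicity fills the gaps between consecutive [k ^ q]. *)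
Require Import Defs.
From HB Require Import structures.
From mathcomp Require Import all_boot all_order all_algebra.
From mathcomp Require Import all_classical all_reals all_analysis measurable_realfun.
From mathcomp Require Import ring lra zify.

Set Implicit Arguments.
Unset Strict Implicit.
Unset Printing Implicit Defensive.

Import Order.TTheory GRing.Theory Num.Theory.
Import numFieldNormedType.Exports.

Local Open Scope classical_set_scope.
Local Open Scope ring_scope.

(** * Fourier analysis on cyclic groups *)

From mathcomp Require Import complex cyclic separable cyclotomic.

(** There are uncountably many systems, so the null set of bad [y] has to be fixed before any system
    is given. Hence all information on [y] is condensed into exponential sums, which mention no
    system, and Parseval converts them into operator bounds valid in every system; this is where the
    exponent 2 enters. Only finitely many roots of unity are tested, so the union bound over them
    costs a factor polynomial in [k], harmless against an exponentially small tail. The scales are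
    balanced. Truncating to [k] digits spoils some time up to [N] with probability of order
    [N r ^ (-k)], summable because [N = k ^ q] is polynomial in [k]. A saving of [1/k] in the
    exponential sums suffices, since only its square has to be summable. Conversely [k ^ q] grows
    slowly enough for the sums of the [w_n] at consecutive scales to have ratio tending to 1, which
    a geometric choice of [N] would not give; this is what lets the gaps be filled without losing
    the limit. *)

Lemma sum_unity_root_expr (C : numClosedFieldType) (M : nat) (u : C) :
  u ^+ M = 1 -> \sum_(k < M) u ^+ k = if u == 1 then M%:R else 0.
Proof.
move=> uM; case: eqP => [->|/eqP u1].
  by under eq_bigr do rewrite expr1n; rewrite sumr_const card_ord.
have : (u - 1) * \sum_(k < M) u ^+ k = 0 by rewrite -subrX1 uM subrr.
by move/eqP; rewrite mulf_eq0 subr_eq0 (negbTE u1)/= => /eqP.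
Qed.

Lemma parseval (C : numClosedFieldType) (M : nat) (w : C) (h : nat -> C) :
  M.-primitive_root w ->
  \sum_(k < M) `|\sum_(j < M) h j * (w ^+ k) ^+ j| ^+ 2 =
  M%:R * \sum_(j < M) `|h j| ^+ 2.
Proof.
move=> pw; have wM := prim_expr_order pw; have M0 := prim_order_gt0 pw.
have w1 : `|w| = 1.
  by apply/eqP; rewrite -(@pexpr_eq1 _ _ M)// -normrX wM normr1.
have w0 : w != 0 by rewrite -normr_eq0 w1 oner_neq0.
have wc : w^* = w^-1 by rewrite invC_norm w1 expr1n invr1 mul1r.
have term (k : 'I_M) : `|\sum_(j < M) h j * (w ^+ k) ^+ j| ^+ 2 =
    \sum_(j < M) \sum_(i < M) h j * (h i)^* * (w ^+ j / w ^+ i) ^+ k.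
  rewrite normCK rmorph_sum/= mulr_suml; apply: eq_bigr => j _.
  rewrite mulr_sumr; apply: eq_bigr => i _.
  rewrite rmorphM !rmorphXn/= wc exprMn !exprVn -!exprM.
  by rewrite (mulnC k j) (mulnC k i); ring.
rewrite (eq_bigr _ (fun k _ => term k)) exchange_big/= mulr_sumr.
apply: eq_bigr => j _; rewrite exchange_big/=.
under eq_bigr do rewrite -mulr_sumr.
rewrite (bigD1 j)//= [X in _ + X]big1 ?addr0.
  by rewrite divff ?expf_neq0// sum_unity_root_expr ?expr1n// eqxx normCK; ring.
move=> i ij; rewrite sum_unity_root_expr; last first.
  by rewrite exprMn exprVn -!exprM ![(_ * M)%N]mulnC !exprM wM !expr1n invr1 mulr1.
rewrite ifN ?mulr0//; apply: contra ij => /eqP /(divr1_eq) /eqP.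
by rewrite (eq_prim_root_expr pw) !modn_small// => /eqP ji; apply/eqP/val_inj.
Qed.

Lemma closed_field_primitive_root (C : numClosedFieldType) (n : nat) :
  (0 < n)%N -> exists z : C, n.-primitive_root z.
Proof.
pose p : {poly C} := 'X^n - 1; have [r Dp] := closed_field_poly_normal p.
move=> n0.
rewrite (monicP _) ?monicXnsubC// scale1r in Dp.
have rn1 : all n.-unity_root r by apply/allP=> z; rewrite -root_prod_XsubC -Dp.
have sz_r : (n < (size r).+1)%N by rewrite -(size_prod_XsubC r id) -Dp size_XnsubC.
have [|z] := hasP (has_prim_root n0 rn1 _ sz_r); last by exists z.
by rewrite -separable_prod_XsubC -Dp separable_Xn_sub_1// pnatr_eq0 -lt0n.
Qed.

(* The correlation of [c] and [g] is cyclic modulo [2 * N], so the discrete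
   Fourier transform diagonalizes it. *)
Lemma correlation_bound (C : numClosedFieldType) (N : nat) (c g : nat -> C) (A : C) :
  0 <= A ->
  (forall z, z ^+ (2 * N) = 1 -> `|\sum_(n < N) c n * z ^+ n| <= A) ->
  \sum_(j < N) `|\sum_(n < N) c n * g (n + j)%N| ^+ 2 <=
  A ^+ 2 * \sum_(m < 2 * N) `|g m| ^+ 2.
Proof.
case: N => [|N] A0 hA; first by rewrite muln0 !big_ord0 mulr0.
move: hA; have [M MN] : exists M, M = (2 * N.+1)%N by exists (2 * N.+1)%N.
rewrite -MN => hA; have M0 : (0 < M)%N by rewrite MN mulnS.
have [w pw] := closed_field_primitive_root C M0; have wM := prim_expr_order pw.
(* For [n, j < N.+1] the index [n + j] stays below [M], so the reduction modulo [M] has no effect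
   there, and the further [j] only add nonnegative terms. This is why the modulus is twice the
   length. *)
pose h j := \sum_(n < N.+1) c n * g ((n + j) %% M)%N.
apply: (@le_trans _ _ (\sum_(j < M) `|h j| ^+ 2)).
  rewrite (big_ord_widen M (fun j => `|\sum_(n < N.+1) c n * g (n + j)%N| ^+ 2)); last first.
    by rewrite MN; lia.
  rewrite [leRHS](bigID (fun j : 'I_M => (j < N.+1)%N))/= ler_wpDr ?sumr_ge0//.
  rewrite le_eqVlt; apply/orP; left; apply/eqP; apply: eq_bigr => j jN.
  congr (`| _ | ^+ 2); apply: eq_bigr => n _; rewrite modn_small//.
  by rewrite [ltnRHS]MN mul2n -addnn -addSn leq_add// ltnW.
have MR : (0 : C) < M%:R by rewrite ltr0n.
rewrite -(ler_pM2l MR) -(parseval h pw) mulrCA -(parseval g pw) mulr_sumr.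
apply: ler_sum => k _; set z := w ^+ k.
have zM : z ^+ M = 1 by rewrite -exprM mulnC exprM wM expr1n.
have z0 : z != 0.
  by apply/eqP => z0; move: zM; rewrite z0 expr0n gtn_eqF// => /eqP; rewrite eq_sym oner_eq0.
have shift n : \sum_(j < M) g ((n + j) %% M)%N * z ^+ j =
    z^-1 ^+ n * \sum_(j < M) g j * z ^+ j.
  rewrite mulr_sumr.
  pose f (j : 'I_M) : 'I_M := Ordinal (ltn_pmod (n + j) M0).
  have finj : injective f.
    move=> i j /(congr1 val)/= /eqP; rewrite eqn_modDl !modn_small// => /eqP.
    exact: val_inj.
  rewrite [RHS](reindex_inj finj)/=; apply: eq_bigr => j _.
  rewrite mulrCA; congr (_ * _).
  have -> : z ^+ ((n + j) %% M) = z ^+ (n + j).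
    by rewrite [in RHS](divn_eq (n + j) M) exprD mulnC exprM zM expr1n mul1r.
  by rewrite exprD mulrA -exprMn mulVf// expr1n mul1r.
(* The transform of a correlation is a product, with the transform of [c] taken at [z^-1], again a
   root of unity. *)
have -> : \sum_(j < M) h j * z ^+ j =
    (\sum_(n < N.+1) c n * z^-1 ^+ n) * \sum_(j < M) g j * z ^+ j.
  rewrite /h; under eq_bigr do rewrite mulr_suml.
  rewrite exchange_big/= mulr_suml; apply: eq_bigr => n _.
  by rewrite -mulrA -shift mulr_sumr; apply: eq_bigr => j _; rewrite mulrA.
rewrite normrM exprMn ler_wpM2r ?exprn_ge0// lerXn2r ?nnegrE//.
by apply: hA; rewrite exprVn zM invr1.
Qed.

Local Open Scope complex_scope.

(* The weights [ws k] are the real and imaginary parts of the powers of the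
   [2 * N]-th roots of unity, [ws 0] being those of [1]. *)
Lemma real_correlation_bound (R : rcfType) (N : nat) :
  exists ws : nat -> nat -> R,
  [/\ forall n, ws 0%N n = 1, forall k n, `|ws k n| <= 1 &
    forall (c g : nat -> R) (A : R), 0 <= A ->
    (forall k, (k < 4 * N)%N -> `|\sum_(n < N) c n * ws k n| <= A) ->
    \sum_(j < N) (\sum_(n < N) c n * g (n + j)%N) ^+ 2 <=
    (2 * A) ^+ 2 * \sum_(m < 2 * N) g m ^+ 2].
Proof.
have [->|N0] := posnP N.
  exists (fun _ _ => 1); split => // [k n|c g A A0 _]; first by rewrite normr1.
  by rewrite muln0 !big_ord0 mulr0.
have M0 : (0 < 2 * N)%N by lia.
have [w pw] := closed_field_primitive_root R[i] M0; have wM := prim_expr_order pw.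
have w1 : `|w| = 1.
  by apply/eqP; rewrite -(@pexpr_eq1 _ _ (2 * N))// -normrX wM normr1.
pose ws k n := if (k < 2 * N)%N then Re ((w ^+ k) ^+ n) else Im ((w ^+ (k - 2 * N)) ^+ n).
have wR (x : R[i]) : `|x| = 1 -> `|Re x| <= 1 /\ `|Im x| <= 1.
  move=> x1; have := normc_def x; rewrite x1 => /(congr1 (fun z => Re z)) /= h.
  have {}h : (Re x) ^+ 2 + (Im x) ^+ 2 = 1.
    by rewrite -[LHS]sqr_sqrtr ?addr_ge0 ?sqr_ge0// -h expr1n.
  by split; rewrite ler_norml; apply/andP; split; nra.
exists ws; split.
- by move=> n; rewrite /ws M0 expr0 expr1n.
- by move=> k n; rewrite /ws; case: ifP => _; apply wR; rewrite !normrX w1 !expr1n.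
move=> c g A A0 hA.
pose cC n := (c n)%:C; pose gC n := (g n)%:C.
(* The factor 2 comes from bounding the real and imaginary parts separately. *)
have hC z : z ^+ (2 * N) = 1 -> `|\sum_(n < N) cC n * z ^+ n| <= (2 * A)%:C.
  move=> /(prim_rootP pw)[[k kM]/= ->].
  have -> : \sum_(n < N) cC n * w ^+ k ^+ n = (\sum_(n < N) c n * ws k n)%:C +
      'i * (\sum_(n < N) c n * ws (2 * N + k)%N n)%:C.
    rewrite !rmorph_sum/= mulr_sumr -big_split/=; apply: eq_bigr => n _.
    rewrite /ws kM ltnNge leq_addr/= addKn /cC; case: (_ ^+ n) => x y /=.
    by apply/eqP; rewrite eq_complex/=; apply/andP; split; apply/eqP; ring.
  apply: (le_trans (ler_normD _ _)); rewrite normrM.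
  have -> : `|'i : R[i]| = 1 by rewrite normc_def/= expr0n expr1n add0r sqrtr1.
  have nC (x : R) : `|x%:C| = (`|x|)%:C by rewrite normc_def/= expr0n addr0 sqrtr_sqr.
  rewrite mul1r !nC -rmorphD/= lecR mulr2n mulrDl mul1r lerD//; apply: hA; lia.
have A0C : 0 <= (2 * A)%:C by rewrite (lecR 0) mulr_ge0.
have := @correlation_bound _ N cC gC _ A0C hC.
have nC (x : R) : `|x%:C| ^+ 2 = (x ^+ 2)%:C.
  by rewrite normc_def/= expr0n addr0 sqrtr_sqr -rmorphXn/= real_normK ?num_real.
under eq_bigr => j _ do under eq_bigr do rewrite -rmorphM.
under eq_bigr => j _ do rewrite -rmorph_sum nC.
under [X in _ <= _ * X]eq_bigr => j _ do rewrite nC.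
by rewrite -!rmorph_sum/= -rmorphXn -rmorphM/= lecR.
Qed.

Local Close Scope complex_scope.

(** * Large deviations of hitting times *)

Lemma sum_ord_mul (V : nmodType) (K B : nat) (F : nat -> V) :
  \sum_(Q < K * B) F Q = \sum_(q < K) \sum_(m < B) F (q * B + m)%N.
Proof.
rewrite -(big_mkord xpredT) big_nat_mul big_mkord; apply: eq_bigr => q _.
by rewrite mulSn addnC -{1}[(q * B)%N]add0n big_addn addKn big_mkord; apply: eq_bigr => m _; rewrite addnC.
Qed.

(** Independence of digits in counting form: for [Q] uniform below [c * B ^ J], the [J] lowest base
    [B] digits are independent and uniform. Peeling off the lowest digit gives the induction. *)
Lemma sum_digit_blocks (R : comPzRingType) (B c J : nat) (g : nat -> nat -> R) :
  (0 < B)%N ->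
  \sum_(Q < c * B ^ J) \prod_(i < J) g i ((Q %/ B ^ i) %% B)%N =
  c%:R * \prod_(i < J) \sum_(m < B) g i m.
Proof.
move=> B0; elim: J g => [|J IH] g.
  under eq_bigr do rewrite big_ord0.
  by rewrite big_ord0 sumr_const card_ord muln1 mulr1.
rewrite expnSr mulnA.
rewrite (sum_ord_mul _ _ (fun Q => \prod_(i < J.+1) g i ((Q %/ B ^ i) %% B)%N)).
under eq_bigr => q _.
  under eq_bigr => m _.
    rewrite big_ord_recl/= expn0 divn1 modnMDl modn_small//.
    under eq_bigr => i _.
      rewrite /bump/= add1n expnS divnMA divnMDl// (divn_small (ltn_ord m)) addn0.
    over.
  over.
  rewrite -mulr_suml.
over.
by rewrite -mulr_sumr (IH (fun i => g i.+1)) big_ord_recl/= mulrCA.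
Qed.

Lemma expR_le_quadratic (R : realType) (x : R) :
  x <= 2^-1 -> expR x <= 1 + x + 2 * x ^+ 2.
Proof.
move=> x2; have h := expR_ge1Dx (- x); have e0 := expR_gt0 (- x).
rewrite -[x in expR x]opprK expRN -[leLHS]mul1r ler_pdivrMr//.
have p : 0 <= 1 + x + 2 * x ^+ 2 by nra.
apply: le_trans (ler_wpM2l p h).
have : 0 <= x ^+ 2 * (1 - 2 * x) by rewrite mulr_ge0 ?sqr_ge0//; lra.
lra.
Qed.

(** Exponential moment of a centred Bernoulli variable of mean [T / B]. Its variance is at most its
    mean, and keeping the mean in the exponent makes the later deviation bound effective for sparse
    hits. *)
Lemma block_exp_moment (R : realType) (B T : nat) (u : R) :
  (0 < B)%N -> (T <= B)%N -> `|u| <= 2^-1 ->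
  \sum_(m < B) expR (u * ((m < T)%N%:R - T%:R / B%:R)) <=
  B%:R * expR (2 * u ^+ 2 * (T%:R / B%:R)).
Proof.
move=> B0 TB u2; set t := T%:R / B%:R.
have BR : (0 : R) < B%:R by rewrite ltr0n.
have t0 : 0 <= t by rewrite divr_ge0.
have t1 : t <= 1 by rewrite ler_pdivrMr// mul1r ler_nat.
have bT : \sum_(m < B) (m < T)%N%:R = B%:R * t :> R.
  rewrite /t mulrCA divff ?gt_eqF// mulr1 -natr_sum; congr _%:R.
  rewrite -(big_mkord xpredT (fun m => (m < T)%N : nat)) (big_cat_nat (leq0n T) TB)/=.
  rewrite big_nat_cond (eq_bigr (fun _ => 1%N)); last by move=> i /andP[/andP[_ ->]].
  rewrite -big_nat_cond sum_nat_const_nat subn0 muln1.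
  by rewrite big_nat_cond big1 ?addn0// => i /andP[/andP[+ _] _]; rewrite leqNgt => /negbTE ->.
(* An indicator equals its square, so the quadratic bound is affine in it and can be averaged
   exactly. *)
have step (m : 'I_B) : expR (u * ((m < T)%N%:R - t)) <=
    1 + (u + 2 * u ^+ 2 * (1 - 2 * t)) * (m < T)%N%:R - u * t + 2 * u ^+ 2 * t ^+ 2.
  set b := (_ < _)%N; have bR : (b%:R : R) = 0 \/ (b%:R : R) = 1 by case: b; [right|left].
  have y1 : `|b%:R - t| <= 1 by rewrite ler_norml; case: bR => ->; lra.
  have uy : u * (b%:R - t) <= 2^-1.
    apply: (le_trans (ler_norm _)); rewrite normrM -[leRHS]mulr1.
    by apply: ler_pM.
  apply: (le_trans (expR_le_quadratic uy)).
  by case: bR => ->; rewrite le_eqVlt; apply/orP; left; apply/eqP; ring.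
apply: le_trans (ler_sum _ (fun m _ => step m)) _.
have sumc (x : R) : \sum_(m < B) x = B%:R * x by rewrite sumr_const card_ord mulr_natl.
rewrite big_split/= sumrB big_split/= -mulr_sumr !sumc bT.
apply: (@le_trans _ _ (B%:R * (1 + 2 * u ^+ 2 * t))); last first.
  by rewrite ler_wpM2l// ?expR_ge1Dx// ltW.
have : 0 <= B%:R * (u ^+ 2 * t ^+ 2) by apply: mulr_ge0; [exact: ltW|apply: mulr_ge0; exact: sqr_ge0].
set b := B%:R; set x := b * (u ^+ 2 * t ^+ 2) => x0.
rewrite [leLHS](_ : _ = b * (1 + 2 * u ^+ 2 * t) - 2 * x); last by rewrite /x; ring.
by rewrite gerBl mulr_ge0.
Qed.

(** Exponential Markov inequality, the exponential of the sum being a product over independent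
    blocks. *)
Lemma block_chernoff (R : realType) (B c J : nat) (T : nat -> nat) (v : nat -> R) (la s : R) :
  (0 < B)%N -> (forall i, (T i <= B)%N) -> (forall i, `|v i| <= 1) ->
  0 < la -> la <= 2^-1 ->
  \sum_(Q < c * B ^ J)
    (s < \sum_(i < J) v i * (((Q %/ B ^ i) %% B < T i)%N%:R - (T i)%:R / B%:R))%R%:R <=
  (c * B ^ J)%:R * expR (2 * la ^+ 2 * (\sum_(i < J) (T i)%:R / B%:R) - la * s).
Proof.
move=> B0 TB v1 la0 la2.
set S := fun Q : nat => \sum_(i < J) v i * (((Q %/ B ^ i) %% B < T i)%N%:R - (T i)%:R / B%:R).
pose g i m := expR (la * v i * ((m < T i)%N%:R - (T i)%:R / B%:R)).
apply: (@le_trans _ _ (\sum_(Q < c * B ^ J) expR (- (la * s)) * \prod_(i < J) g i ((Q %/ B ^ i) %% B)%N)).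
  apply: ler_sum => Q _; rewrite /g -expR_sum.
  have -> : \sum_(i < J) la * v i * (((Q %/ B ^ i) %% B < T i)%N%:R - (T i)%:R / B%:R) = la * S Q.
    by rewrite /S mulr_sumr; apply: eq_bigr => i _; rewrite mulrA.
  rewrite -expRD; case: (ltP s (S Q)) => h; last exact: expR_ge0.
  apply: le_trans (expR_ge1Dx _); rewrite lerDl addrC -mulrBr mulr_ge0 ?subr_ge0//; exact: ltW.
rewrite -mulr_sumr sum_digit_blocks// expRD natrM.
set E := expR (2 * _ * _); set P := \prod_(i < J) _.
suff h : P <= (B ^ J)%:R * E.
  rewrite [leLHS](_ : _ = expR (- (la * s)) * c%:R * P); last by ring.
  rewrite [leRHS](_ : _ = expR (- (la * s)) * c%:R * ((B ^ J)%:R * E)); last by ring.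
  by rewrite ler_wpM2l// mulr_ge0 ?expR_ge0.
rewrite /P /E natrX mulr_sumr expR_sum.
have -> : B%:R ^+ J = \prod_(i < J) B%:R :> R by rewrite prodr_const card_ord.
rewrite -big_split/=; apply: ler_prod => i _; apply/andP; split.
  by apply: sumr_ge0 => m _; exact: expR_ge0.
apply: (le_trans (block_exp_moment B0 (TB i) _)).
  by rewrite normrM (gtr0_norm la0) (le_trans _ la2)// ler_piMr// ltW.
rewrite ler_wpM2l// ler_expR ler_wpM2r ?divr_ge0// ler_wpM2l//.
by rewrite exprMn ler_piMr ?sqr_ge0// -real_normK ?num_real// exprn_ile1.
Qed.

Lemma block_chernoff_abs (R : realType) (B c J : nat) (T : nat -> nat) (v : nat -> R) (la s : R) :
  (0 < B)%N -> (forall i, (T i <= B)%N) -> (forall i, `|v i| <= 1) ->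
  0 < la -> la <= 2^-1 ->
  \sum_(Q < c * B ^ J)
    (s < `|\sum_(i < J) v i * (((Q %/ B ^ i) %% B < T i)%N%:R - (T i)%:R / B%:R)|)%R%:R <=
  2 * ((c * B ^ J)%:R * expR (2 * la ^+ 2 * (\sum_(i < J) (T i)%:R / B%:R) - la * s)).
Proof.
move=> B0 TB v1 la0 la2.
have h1 := block_chernoff c J s B0 TB v1 la0 la2.
have v2 i : `|- v i| <= 1 by rewrite normrN.
have h2 := block_chernoff c J s B0 TB v2 la0 la2.
rewrite mulr2n mulrDl mul1r; apply: le_trans (lerD h1 h2).
rewrite -big_split/=; apply: ler_sum => Q _.
under [X in _ <= _ + (s < X)%R%:R]eq_bigr do rewrite mulNr.
rewrite sumrN; set x := \sum_(_ < _) _; clearbody x.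
by case: (ger0P x) => _; rewrite ?lerDl ?lerDr ler0n.
Qed.

(* The outer Lebesgue measure of [A] is at most [e]. *)
Definition covered (R : realType) (A : set R) (e : R) : Prop :=
  exists E, [/\ measurable E, (lebesgue_measure E <= e%:E)%E & A `<=` E].

Lemma covered_le (R : realType) (A B : set R) (e e' : R) :
  A `<=` B -> e <= e' -> covered B e -> covered A e'.
Proof.
move=> AB ee [E [mE Ee BE]]; exists E; split => //.
  by rewrite (le_trans Ee)// lee_fin.
exact: subset_trans BE.
Qed.

Lemma coveredU (R : realType) (A B : set R) (e e' : R) :
  covered A e -> covered B e' -> covered (A `|` B) (e + e').
Proof.
move=> [E [mE Ee AE]] [F [mF Fe BF]]; exists (E `|` F); split.
- exact: measurableU.
- by apply: (le_trans (measureU2 _ mE mF)); rewrite EFinD leeD.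
- exact: setUSS.
Qed.

Lemma covered_bigcup (R : realType) (n : nat) (A : nat -> set R) (e : nat -> R) :
  (forall i, (i < n)%N -> covered (A i) (e i)) ->
  covered [set y | exists2 i, (i < n)%N & A i y] (\sum_(i < n) e i).
Proof.
elim: n => [|n IH] hA.
  by exists set0; split => //; [rewrite measure0 big_ord0|move=> y [j]; rewrite ltn0].
rewrite big_ord_recr/=.
apply: covered_le (coveredU (IH _) (hA n (ltnSn n))) => //; last by move=> i /ltnW/hA.
move=> y [j]; rewrite ltnS leq_eqVlt => /predU1P[->|? ?]; first by right.
by left; exists j.
Qed.

(** Passage from counting to Lebesgue measure: [Num.truncn (n%:R * y)] is constant on intervals of
    length [n%:R^-1]. *)
Lemma covered_truncn (R : realType) (n : nat) (p : pred nat) : (0 < n)%N ->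
  covered [set y : R | 0 <= y < 1 /\ p (Num.truncn (n%:R * y))]
    (n%:R^-1 * \sum_(Q < n) (p Q)%:R).
Proof.
move=> n0; have nR : (0 : R) < n%:R by rewrite ltr0n.
rewrite mulr_sumr; apply: (@covered_le _ _ [set y | exists2 i, (i < n)%N &
    p i /\ (i%:R / n%:R <= y < i.+1%:R / n%:R)] _ _ _ (lexx _)).
  move=> y /= [/andP[y0 y1] py].
  have ny0 : 0 <= n%:R * y by rewrite mulr_ge0.
  have /andP[h1 h2] := truncn_itv ny0.
  exists (Num.truncn (n%:R * y)).
    by rewrite -(ltr_nat R) (le_lt_trans h1)// -[ltRHS]mulr1 ltr_pM2l.
  by split => //; rewrite ler_pdivrMr// ltr_pdivlMr// [y * _]mulrC h1.
apply: (@covered_bigcup _ _ (fun i => [set y | p i /\ (i%:R / n%:R <= y < i.+1%:R / n%:R)])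
  (fun i => n%:R^-1 * (p i)%:R)) => i _; case: (p i); last first.
  by exists set0; split => //; [rewrite measure0 mulr0|move=> y []].
exists `[i%:R / n%:R, i.+1%:R / n%:R[%classic; split => //.
  rewrite lebesgue_measure_itv/= lte_fin ltr_pM2r ?invr_gt0// ltr_nat ltnSn.
  by rewrite -EFinD lee_fin -mulrBl -natrB// subSnn mul1r mulr1.
by move=> y [_]; rewrite /= in_itv.
Qed.

(** For [n] a power of the base this drops trailing digits, so a single truncation of [y] contains
    all the blocks of a residue class. *)
Lemma truncn_divn (R : realType) (x : R) (n : nat) : 0 <= x -> (0 < n)%N ->
  (Num.truncn (n%:R * x) %/ n)%N = Num.truncn x.
Proof.
move=> x0 n0; have nR : (0 : R) < n%:R by rewrite ltr0n.
have nx0 : 0 <= n%:R * x by rewrite mulr_ge0.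
have /andP[h1 h2] := truncn_itv nx0.
apply/esym/truncn_def; apply/andP; split.
  rewrite -(ler_pM2l nR) -natrM (le_trans _ h1)// ler_nat mulnC leq_divM//.
rewrite -(ltr_pM2l nR) (lt_le_trans h2)// -natrM ler_nat mulnC.
by rewrite -ltn_divLR.
Qed.

Lemma frac_part_block (R : realType) (x : R) (B : nat) :
  let m := (Num.truncn (B%:R * x) %% B)%N in 0 <= x -> (0 < B)%N ->
  m%:R <= B%:R * frac_part x < m.+1%:R.
Proof.
move=> m x0 B0.
have Bx0 : 0 <= B%:R * x by rewrite mulr_ge0.
have := truncn_itv Bx0; set Q := Num.truncn _ in m *.
have -> : frac_part x = x - (Num.truncn x)%:R.
  rewrite /frac_part truncn_floor x0 natr_absz ger0_norm ?floor_ge0//.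
rewrite -(truncn_divn x0 B0) -/Q mulrBr -natrM.
rewrite [X in X%:R <= _ < _](divn_eq Q B) -/m [X in _ < X.+1%:R](divn_eq Q B) -/m.
rewrite -addnS !natrD mulnC => /andP[h1 h2].
by apply/andP; split; lra.
Qed.

(** The block [m] locates the fractional part in a cell of length [1 / B]. In the cell [m = 0] the
    fractional part may vanish, and the cell [m = T] contains the threshold; on every other cell the
    condition is decided by [m]. *)
Lemma hitting_times_block (R : realType) (a y : R) (r n B : nat) :
  0 <= y -> (0 < B)%N ->
  let w := n%:R `^ (- a) in
  let m := (Num.truncn (B%:R * (r%:R ^+ n * y)) %% B)%N in
  let T := Num.truncn (w * B%:R) in
  (0 < n)%N -> m != 0%N -> m != T ->
  `[< hitting_times a r y n >] = (m < T)%N.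
Proof.
move=> y0 B0 w m T n0 m0 mT; have BR : (0 : R) < B%:R by rewrite ltr0n.
have x0 : 0 <= r%:R ^+ n * y by rewrite mulr_ge0 ?exprn_ge0.
have := frac_part_block x0 B0; rewrite -/m; set f := frac_part _ => /andP[h1 h2].
have wB0 : 0 <= w * B%:R by rewrite mulr_ge0 ?powR_ge0.
have /andP[t1 t2] := truncn_itv wB0; rewrite -/T in t1 t2.
have f0 : 0 < f.
  by rewrite -(pmulr_rgt0 _ BR) (lt_le_trans _ h1)// ltr0n lt0n.
apply/asboolP/idP => [[_ /andP[_]]|mlT].
  rewrite -/f -/w => fw; rewrite ltn_neqAle mT/= -ltnS -(ltr_nat R).
  by rewrite (le_lt_trans h1)// (lt_trans _ t2)// mulrC ltr_pM2r.
split => //; rewrite -/f -/w f0/= -(ltr_pM2l BR) (lt_le_trans h2)// mulrC.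
by rewrite (le_trans _ t1)// ler_nat.
Qed.

(* The index [n] of [hit] and [weight] stands for the time [n.+1]. *)
Definition hit (R : realType) (a : R) (r : nat) (y : R) (n : nat) : nat :=
  `[< hitting_times a r y n.+1 >].

Definition weight (R : realType) (a : R) (n : nat) : R := n.+1%:R `^ (- a).

Lemma weight_gt0 (R : realType) (a : R) n : 0 < weight a n.
Proof. exact: powR_gt0. Qed.

Lemma weight_le1 (R : realType) (a : R) n : 0 <= a -> weight a n <= 1.
Proof.
move=> a0; rewrite /weight powRN invf_le1 ?powR_gt0//.
by rewrite -[leLHS](powRr0 n.+1%:R) ler_powR// ler1n.
Qed.

Lemma weight_nincr (R : realType) (a : R) m n : 0 <= a -> (m <= n)%N -> weight a n <= weight a m.
Proof.
move=> a0 mn; rewrite /weight !powRN lef_pV2 ?posrE ?powR_gt0//.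
by apply: ge0_ler_powR; rewrite ?nnegrE// ler_nat.
Qed.

(** Each class is listed from its latest time backwards, because block [i] of an integer is counted
    from the least significant digits, which the latest time reads. *)
Lemma sum_residue_classes (V : nmodType) (J k : nat) (F : nat -> V) :
  \sum_(n < J * k) F n = \sum_(l < k) \sum_(i < J) F ((J - i.+1) * k + l)%N.
Proof.
rewrite (sum_ord_mul J k F) exchange_big/=; apply: eq_bigr => l _.
by rewrite (reindex_inj rev_ord_inj).
Qed.

Lemma residue_class_lt (J k l i : nat) : (l < k)%N -> (i < J)%N ->
  ((J - i.+1) * k + l < J * k)%N.
Proof.
move=> lk iJ; apply: (@leq_trans ((J - i.+1) * k + k)%N); first by rewrite ltn_add2l.
by rewrite -mulSnr leq_mul2r; apply/orP; right; lia.
Qed.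

(* Within a residue class modulo [k] the digit blocks of length [k] read by the
   hitting conditions are disjoint, hence independent.  Truncating the
   threshold to a multiple of [r ^- k] makes each condition depend on its block
   only, except when the block is [0] or the truncated threshold. *)
Lemma large_deviation (R : realType) (a : R) (r k J M : nat) (ws : nat -> nat -> R) (la s : R) :
  0 < a -> (0 < r)%N -> (0 < k)%N -> (forall j n, `|ws j n| <= 1) ->
  0 < la -> la <= 2^-1 ->
  let B := (r ^ k)%N in let N := (J * k)%N in
  covered [set y : R | 0 <= y < 1 /\ exists2 j, (j < M)%N &
      k%:R * s + N%:R / B%:R < `|\sum_(n < N) ((hit a r y n)%:R - weight a n) * ws j n|]
    (N%:R * (2 / B%:R) + M%:R * (k%:R *
      (2 * expR (2 * la ^+ 2 * (\sum_(n < N) weight a n) - la * s)))).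
Proof.
move=> a0 r0 k0 ws1 la0 la2 B N.
have B0 : (0 < B)%N by rewrite expn_gt0 r0.
have BR : (0 : R) < B%:R by rewrite ltr0n.
pose T n := Num.truncn (weight a n * B%:R).
have wB0 n : 0 <= weight a n * B%:R by rewrite mulr_ge0// ltW ?weight_gt0.
have Tw n : (T n)%:R / B%:R <= weight a n.
  by rewrite ler_pdivrMr//; have /andP[] := truncn_itv (wB0 n).
have wT n : weight a n - (T n)%:R / B%:R <= B%:R^-1.
  rewrite lerBlDr -[X in X + _]mul1r -mulrDl [1 + _]addrC natr1 ler_pdivlMr//.
  by have /andP[_ /ltW] := truncn_itv (wB0 n).
have TB n : (T n <= B)%N.
  rewrite -(ler_nat R); have /andP[h _] := truncn_itv (wB0 n).
  by rewrite (le_trans h)// ler_piMl// weight_le1// ltW.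
pose idx l i := ((J - i.+1) * k + l)%N.
pose p1 n Q := (Q %% B == 0)%N || (Q %% B == T n)%N.
pose S j l Q := \sum_(i < J) ws j (idx l i) *
  (((Q %/ B ^ i) %% B < T (idx l i))%N%:R - (T (idx l i))%:R / B%:R).
pose p2 j l Q := s < `|S j l Q|.
(* [A1] collects the [y] with an ambiguous block at some time, two values out of [B] each time; [A2]
   those for which some residue class deviates by more than [s]. Outside both the bound is
   deterministic. *)
pose A1 := [set y : R | exists2 n, (n < N)%N &
  0 <= y < 1 /\ p1 n (Num.truncn ((r ^ n.+1 * B)%N%:R * y))].
pose A2 := [set y : R | exists2 j, (j < M)%N & exists2 l, (l < k)%N &
  0 <= y < 1 /\ p2 j l (Num.truncn ((r ^ l.+1 * B ^ J)%N%:R * y))].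
have rn m : (0 < r ^ m)%N by rewrite expn_gt0 r0.
have c1 : covered A1 (N%:R * (2 / B%:R)).
  have -> : N%:R * (2 / B%:R) = \sum_(n < N) 2 / B%:R :> R.
    by rewrite sumr_const card_ord mulr_natl.
  apply: (@covered_bigcup _ N (fun n => [set y | 0 <= y < 1 /\
    p1 n (Num.truncn ((r ^ n.+1 * B)%N%:R * y))]) (fun=> 2 / B%:R)) => n _.
  have nB0 : (0 < r ^ n.+1 * B)%N by rewrite muln_gt0 rn.
  apply: (@covered_le _ _ _ _ _ _ _ (@covered_truncn R _ (p1 n) nB0)) => //.
  have := @sum_digit_blocks R B (r ^ n.+1) 1 (fun _ m => ((m == 0)%N || (m == T n)%N)%:R) B0.
  rewrite expn1; under eq_bigr do rewrite big_ord1 expn0 divn1.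
  rewrite big_ord1 => ->; rewrite natrM.
  rewrite [leLHS](_ : _ = B%:R^-1 * \sum_(m < B) ((m == 0%N :> nat) || (m == T n :> nat))%:R); last first.
    by field; rewrite ?gt_eqF// ltr0n.
  rewrite [leRHS]mulrC ler_wpM2l ?invr_ge0//.
  apply: (@le_trans _ _ (\sum_(m < B) ((m == 0%N :> nat)%:R + (m == T n :> nat)%:R))).
    by apply: ler_sum => m _; case: (_ == 0%N); case: (_ == _); rewrite /= ?lerDl ?addr0 ?add0r.
  have delta t : \sum_(m < B) (m == t :> nat)%:R <= 1 :> R.
    have [tB|Bt] := ltnP t B.
      rewrite (bigD1 (Ordinal tB))//= eqxx big1 ?addr0// => m mt.
      by rewrite (_ : (_ == _) = false)//; apply/negbTE.
    by rewrite big1// => m _; rewrite ltn_eqF// (leq_trans _ Bt).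
  by rewrite big_split/=; apply: lerD; exact: delta.
have c2 : covered A2 (M%:R * (k%:R *
      (2 * expR (2 * la ^+ 2 * (\sum_(n < N) weight a n) - la * s)))).
  set e := 2 * expR _.
  have -> : M%:R * (k%:R * e) = \sum_(j < M) \sum_(l < k) e.
    by rewrite !sumr_const !card_ord !mulr_natl.
  apply: (@covered_bigcup _ M (fun j => [set y | exists2 l, (l < k)%N &
     0 <= y < 1 /\ p2 j l (Num.truncn ((r ^ l.+1 * B ^ J)%N%:R * y))])
     (fun=> \sum_(l < k) e)) => j _.
  apply: (@covered_bigcup _ k (fun l => [set y |
     0 <= y < 1 /\ p2 j l (Num.truncn ((r ^ l.+1 * B ^ J)%N%:R * y))])
     (fun=> e)) => l lk.
  have n0 : (0 < r ^ l.+1 * B ^ J)%N by rewrite muln_gt0 rn expn_gt0 B0.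
  apply: (@covered_le _ _ _ _ _ _ _ (@covered_truncn R _ (p2 j l) n0)) => //.
  rewrite ler_pdivrMl ?ltr0n//.
  apply: le_trans (@block_chernoff_abs R B (r ^ l.+1) J (fun i => T (idx l i))
    (fun i => ws j (idx l i)) la s B0 _ _ la0 la2) _ => //.
  rewrite /e mulrCA ler_wpM2l// ler_wpM2l// ler_expR lerD2r.
  rewrite ler_wpM2l ?mulr_ge0 ?exprn_ge0 ?(ltW la0)//.
  rewrite (sum_residue_classes J k) (bigD1 (Ordinal lk))//= ler_wpDr//.
    by apply: sumr_ge0 => i _; apply: sumr_ge0 => ? _; rewrite ltW ?weight_gt0.
  by apply: ler_sum => i _; exact: Tw.
apply: (covered_le _ (lexx _) (coveredU c1 c2)) => y /= [y01 [j jM]].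
have y0 : 0 <= y by case/andP: y01.
apply: contraPP => /not_orP[nA1 nA2]; apply/negP; rewrite -leNgt.
have hitT n : (n < N)%N ->
    hit a r y n = (Num.truncn ((r ^ n.+1 * B)%N%:R * y) %% B < T n)%N :> nat.
  move=> nN; rewrite /hit.
  have E : (r ^ n.+1 * B)%N%:R * y = B%:R * (r%:R ^+ n.+1 * y) by rewrite natrM natrX; ring.
  have : ~ p1 n (Num.truncn ((r ^ n.+1 * B)%N%:R * y)) by move=> h; apply: nA1; exists n.
  rewrite /p1 E => /negP; rewrite negb_or => /andP[h1 h2].
  by rewrite (hitting_times_block y0 B0).
have Sle l : (l < k)%N -> `|S j l (Num.truncn ((r ^ l.+1 * B ^ J)%N%:R * y))| <= s.
  by move=> lk; rewrite leNgt; apply/negP => h; apply: nA2; exists j => //; exists l.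
have Sl (l : 'I_k) : S j l (Num.truncn ((r ^ l.+1 * B ^ J)%N%:R * y)) =
   \sum_(i < J) ((hit a r y (idx l i))%:R - (T (idx l i))%:R / B%:R) * ws j (idx l i).
  apply: eq_bigr => i _; rewrite mulrC; congr ((_%:R - _) * _).
  rewrite hitT; last exact: residue_class_lt.
  (* Deleting the last [i] blocks exposes the block of time [idx l i], as [r ^ l.+1 * B ^ J] equals
     [r ^ (idx l i).+1 * B * B ^ i]. *)
  rewrite -(@truncn_divn _ ((r ^ (idx l i).+1 * B)%:R * y) (B ^ i)) ?mulr_ge0 ?expn_gt0 ?B0 ?r0//.
  rewrite mulrA -natrM; congr (((Num.truncn (_%:R * _) %/ _) %% _ < _)%N : nat).
  rewrite /B /idx -!expnM -!expnD; congr (_ ^ _)%N.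
  by have := ltn_ord i; nia.
(* Replacing the weights by the truncated means costs at most [B%:R^-1] per time, whence the term
   [N%:R / B%:R]. *)
have -> : \sum_(n < N) ((hit a r y n)%:R - weight a n) * ws j n =
    \sum_(n < N) ((hit a r y n)%:R - (T n)%:R / B%:R) * ws j n +
    \sum_(n < N) ((T n)%:R / B%:R - weight a n) * ws j n.
  by rewrite -big_split/=; apply: eq_bigr => n _; ring.
apply: (le_trans (ler_normD _ _)); apply: lerD.
  rewrite (sum_residue_classes J k (fun n => ((hit a r y n)%:R - (T n)%:R / B%:R) * ws j n)).
  apply: (le_trans (ler_norm_sum _ _ _)).
  have -> : k%:R * s = \sum_(l < k) s by rewrite sumr_const card_ord mulr_natl.
  by apply: ler_sum => l _; rewrite -Sl; exact: Sle.
apply: (le_trans (ler_norm_sum _ _ _)).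
have -> : N%:R / B%:R = \sum_(n < N) B%:R^-1 :> R by rewrite sumr_const card_ord mulr_natl.
apply: ler_sum => n _; rewrite normrM -[leRHS]mulr1; apply: ler_pM => //.
by rewrite ler_norml; apply/andP; split; have := Tw n; have := wT n; have : 0 <= (B%:R : R)^-1; rewrite ?invr_ge0//; lra.
Qed.

(** The rate 1/8 is the one that the Chernoff bound delivers in [ae_exponential_sums]. *)
Lemma natr_exp_le_expR (R : realType) (m : nat) :
  exists2 C : R, 0 <= C & forall k : nat, k%:R ^+ m <= C * expR (k%:R / 8).
Proof.
have [->|m0] := posnP m.
  by exists 1 => // k; rewrite expr0 mul1r -[leLHS](expR0 R) ler_expR divr_ge0.
have mR : (0 : R) < m%:R by rewrite ltr0n.
exists ((8 * m%:R) ^+ m) => [|k]; first by rewrite exprn_ge0// mulr_ge0.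
rewrite [k%:R / 8](_ : _ = m%:R * (k%:R / (8 * m%:R))); last by field; rewrite gt_eqF.
rewrite expRM_natl -exprMn lerXn2r ?nnegrE ?mulr_ge0 ?expR_ge0//.
rewrite -ler_pdivrMl ?mulr_gt0// mulrC.
by apply: le_trans (expR_ge1Dx _); rewrite lerDr.
Qed.

Lemma expR_le_natr_exp (R : realType) (r k : nat) : (2 <= r)%N -> expR (k%:R / 8) <= r%:R ^+ k :> R.
Proof.
move=> r2; rewrite expRM_natl lerXn2r ?nnegrE ?expR_ge0//.
apply: le_trans (expR_le_quadratic _) _; first lra.
by apply: (@le_trans _ _ 2); [lra|rewrite (ler_nat R 2)].
Qed.

Lemma sum_weight_ge (R : realType) (a : R) (N : nat) : 0 <= a -> (0 < N)%N ->
  N%:R `^ (1 - a) <= \sum_(n < N) weight a n.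
Proof.
move=> a0; case: N => // N _.
rewrite powRD; last by apply/implyP => _; rewrite pnatr_eq0.
rewrite powRr1// mulr_natl -[X in _ *+ X]card_ord -sumr_const.
by apply: ler_sum => n _; rewrite -/(weight a N) weight_nincr// -ltnS.
Qed.

Lemma sum_inv_sqr_le (R : realType) n : \sum_(k < n) (k.+1%:R ^+ 2)^-1 <= 2 :> R.
Proof.
suff h m : \sum_(k < m.+1) (k.+1%:R ^+ 2)^-1 <= 2 - m.+1%:R^-1 :> R.
  case: n => [|n]; first by rewrite big_ord0.
  by apply: (le_trans (h n)); rewrite gerBl invr_ge0.
elim: m => [|m IH]; first by rewrite big_ord1 expr1n invr1; lra.
rewrite big_ord_recr/=; apply: le_trans (lerD IH (lexx _)) _.
rewrite -[X in _ <= 2 - X^-1]natr1 -[X in X ^+ 2]natr1.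
have : (0 : R) < m.+1%:R by rewrite ltr0n.
move: (m.+1%:R : R) => x x0; rewrite -subr_ge0.
rewrite [X in 0 <= X](_ : _ = (x * (x + 1) ^+ 2)^-1); last by field; lra.
by rewrite invr_ge0 mulr_ge0 ?sqr_ge0// ltW.
Qed.

Lemma nneseries_inv_sqr_lty (R : realType) (C : R) (u : nat -> \bar R) :
  (forall k, (0 <= u k)%E) -> (forall k, (u k <= (C * (k.+1%:R ^+ 2)^-1)%:E)%E) ->
  (\sum_(k <oo) u k < +oo)%E.
Proof.
move=> u0 uC; have C0 : 0 <= C.
  by have := le_trans (u0 0%N) (uC 0%N); rewrite lee_fin expr1n invr1 mulr1.
apply: (@le_lt_trans _ _ (C * 2)%:E); last exact: ltry.
apply: lime_le; first by apply: is_cvg_nneseries => n _ _; exact: u0.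
apply: nearW => n; apply: (@le_trans _ _ (\sum_(0 <= k < n) (C * (k.+1%:R ^+ 2)^-1)%:E)%E).
  by apply: lee_sum => k _; exact: uC.
rewrite sumEFin lee_fin -mulr_sumr big_mkord.
by rewrite ler_wpM2l// sum_inv_sqr_le.
Qed.

(** Borel-Cantelli, applied to the measurable covers rather than to the sets themselves. *)
Lemma ae_eventually_not (R : realType) (C : R) (A : nat -> set R) :
  (forall k, covered (A k) (C * (k.+1%:R ^+ 2)^-1)) ->
  {ae lebesgue_measure, forall y : R, exists k0, forall k, (k0 <= k)%N -> ~ A k y}.
Proof.
move=> /choice[E EP]; exists (lim_sup_set E); split.
- apply: bigcap_measurable => // k _; apply: bigcup_measurable => j _.
  by have [] := EP j.
- apply: lim_sup_set_cvg0; first by move=> k; have [] := EP k.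
  by apply: (@nneseries_inv_sqr_lty _ C) => // k; have [] := EP k.
- move=> y /= nP m _; apply: contrapT => h; apply: nP; exists m => k mk Ak.
  by apply: h; exists k => //; have [_ _] := EP k; exact.
Qed.

(** With [K = k.+1] there are [K] residue classes, each allowed to deviate by [W / K ^+ 2]. The
    Chernoff exponent [2 * la ^+ 2 * W - la * W / K ^+ 2] is minimal at [la = (4 * K ^+ 2)^-1], with
    value [- W / (8 * K ^+ 4)]; this is at most [- K / 8] once [W >= K ^+ 5]. *)
Lemma ae_exponential_sums (R : realType) (a : R) (r : nat) (ws : nat -> nat -> nat -> R) :
  0 < a -> a < 1 -> (2 <= r)%N -> (forall N j n, `|ws N j n| <= 1) ->
  exists q : nat, (0 < q)%N /\ exists2 C : R, 0 <= C &
  {ae lebesgue_measure, forall y : R, 0 <= y <= 1 ->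
    exists k0, forall k, (k0 <= k)%N -> forall j, (j < 4 * k.+1 ^ q)%N ->
    `|\sum_(n < k.+1 ^ q) ((hit a r y n)%:R - weight a n) * ws (k.+1 ^ q)%N j n| <=
    C * (\sum_(n < k.+1 ^ q) weight a n) / k.+1%:R}.
Proof.
move=> a0 a1 r2 ws1; have a1' : 0 < 1 - a by rewrite subr_gt0.
have r0 : (0 < r)%N by exact: ltn_trans r2.
(* This gives [q * (1 - a) >= 5], hence [W k >= k.+1 ^ 5]; the form [q = p.+1] makes [k.+1 ^ q] a
   multiple of the block length. *)
pose p := Num.truncn (5 / (1 - a)); pose q := p.+1.
have q5 : 5 <= q%:R * (1 - a).
  rewrite -ler_pdivrMr// ltW//.
  by have /andP[] := @truncn_itv _ (5 / (1 - a)) (divr_ge0 (ler0n _ _) (ltW a1')).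
exists q; split => //.
pose W k := \sum_(n < k.+1 ^ q) weight a n.
have W5 k : k.+1%:R ^+ 5 <= W k.
  apply: le_trans (sum_weight_ge (ltW a0) _); last by rewrite expn_gt0.
  rewrite natrX -!powR_mulrn// -powRrM ler_powR// ler1n//.
have W1 k : 1 <= W k by apply: le_trans (W5 k); rewrite exprn_ege1// ler1n.
(* [C1] absorbs the truncation error [k.+1 ^ q / r ^ k.+1] into [W k / k.+1]. In [C2] two extra
   powers yield the summable factor [(k.+1%:R ^+ 2)^-1]. *)
have [C1 C10 hC1] := natr_exp_le_expR R q.+1.
have [C2 C20 hC2] := natr_exp_le_expR R q.+3.
exists (1 + C1); first by rewrite addr_ge0.
pose A k := [set y : R | 0 <= y < 1 /\ exists2 j, (j < 4 * k.+1 ^ q)%N &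
    W k / k.+1%:R + (k.+1 ^ q)%:R / (r ^ k.+1)%:R <
      `|\sum_(n < k.+1 ^ q) ((hit a r y n)%:R - weight a n) * ws (k.+1 ^ q)%N j n|].
have covA k : covered (A k) ((10 * C2) * (k.+1%:R ^+ 2)^-1).
  set K : R := k.+1%:R; have K0 : 0 < K by rewrite ltr0n.
  have K1 : 1 <= K by rewrite ler1n.
  have la0 : 0 < (4 * K ^+ 2)^-1 by rewrite invr_gt0 mulr_gt0// exprn_gt0.
  have la2 : (4 * K ^+ 2)^-1 <= 2^-1.
    rewrite lef_pV2 ?posrE ?mulr_gt0 ?exprn_gt0//.
    have : 1 <= K ^+ 2 by rewrite exprn_ege1.
    lra.
  have := @large_deviation R a r k.+1 (k.+1 ^ p) (4 * k.+1 ^ q) (ws (k.+1 ^ q)%N) _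
    (W k / K ^+ 2) a0 r0 (ltn0Sn k) (ws1 _) la0 la2.
  rewrite /= -expnSr -/q; apply: covered_le.
    move=> y [y01 [j jM h]]; split => //; exists j => //.
    by rewrite [_ * (_ / _)](_ : _ = W k / K)//; field; rewrite gt_eqF.
  have eK : expR (2 * (4 * K ^+ 2)^-1 ^+ 2 * W k - (4 * K ^+ 2)^-1 * (W k / K ^+ 2)) <=
      (expR (K / 8))^-1.
    rewrite -expRN ler_expR.
    rewrite [leLHS](_ : _ = - ((W k / K ^+ 4) / 8)); last by field; rewrite gt_eqF.
    rewrite lerN2 ler_pM2r ?invr_gt0// ler_pdivlMr ?exprn_gt0//.
    by rewrite -exprS; exact: W5.
  have rK : (r ^ k.+1)%:R^-1 <= (expR (K / 8))^-1.
    rewrite lef_pV2 ?posrE ?expR_gt0 ?ltr0n ?expn_gt0 ?r0//.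
    by rewrite natrX; exact: expR_le_natr_exp.
  apply: (@le_trans _ _ (10 * K ^+ q.+1 * (expR (K / 8))^-1)).
    rewrite natrM natrX -/K.
    have Kq : 0 <= K ^+ q by rewrite exprn_ge0// ltW.
    have KK : K ^+ q <= K ^+ q.+1 by rewrite exprS ler_peMl.
    have i0 : 0 <= (expR (K / 8))^-1 by rewrite invr_ge0 expR_ge0.
    have h1 : K ^+ q * (2 / (r ^ k.+1)%:R) <= 2 * K ^+ q.+1 * (expR (K / 8))^-1.
      rewrite mulrCA mulrA ler_pM ?mulr_ge0 ?invr_ge0//.
      by rewrite ler_wpM2l.
    apply: (le_trans (lerD h1 (lexx _))).
    rewrite [leRHS](_ : _ = 2 * K ^+ q.+1 * (expR (K / 8))^-1 +
       4 * K ^+ q * (K * (2 * (expR (K / 8))^-1))); last by rewrite exprS; ring.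
    by rewrite lerD2l !ler_wpM2l ?mulr_ge0// ltW.
  rewrite -mulrA -[10 * C2 * _]mulrA ler_wpM2l//.
  rewrite ler_pdivrMr ?expR_gt0// mulrAC -ler_pdivrMr ?invr_gt0 ?exprn_gt0// invrK.
  by rewrite -exprD addn2; exact: hC2.
(* The deviation estimate concerns [y < 1] only, so the point 1 is discarded as a null set. *)
have neg1 : lebesgue_measure.-negligible [set (1 : R)].
  by apply/negligibleP => //; exact: lebesgue_measure_set1.
have aeN1 : {ae lebesgue_measure, forall y : R, y <> 1}.
  by apply: negligibleS neg1 => y /= /contrapT.
have F := ae_filter_ringOfSetsType (@lebesgue_measure R).
apply: (@filterS _ _ F _ _ _ (@filterI _ _ F _ _ aeN1 (ae_eventually_not covA))).
move=> y [y1 [k0 hk0]] /andP[y0 yle1].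
exists k0 => k /hk0 nA j jM; have {}y1 : y < 1 by rewrite lt_neqAle yle1 andbT; exact/eqP.
rewrite leNgt; apply/negP => h; apply: nA; split; first by rewrite y0.
exists j => //; apply: le_lt_trans h.
have K0 : (0 : R) < k.+1%:R by rewrite ltr0n.
rewrite -/(W k) mulrDl mul1r mulrDl lerD2l ler_pdivlMr// -mulrA.
rewrite mulrA mulrAC [X in X * _ / _]natrX -exprSr.
rewrite ler_pdivrMr ?ltr0n ?expn_gt0 ?r0// natrX.
apply: (le_trans (hC1 _)).
rewrite -mulrA ler_wpM2l//; apply: le_trans (expR_le_natr_exp _ k.+1 r2) _.
by rewrite ler_peMl// exprn_ge0.
Qed.

(** * The pointwise ergodic theorem *)

Lemma measurable_iter d (X : measurableType d) (T : X -> X) (n : nat) :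
  measurable_fun setT T -> measurable_fun setT (iter n T).
Proof.
move=> mT; elim: n => [|n IH]; first exact: measurable_id.
exact: (measurableT_comp mT IH).
Qed.

Lemma ge0_integral_measure_preserving d (X : measurableType d) (R : realType)
    (mu : probability X R) (T : X -> X) (g : X -> \bar R) :
  measure_preserving mu T -> measurable_fun setT g -> (forall x, (0 <= g x)%E) ->
  (\int[mu]_x g (T x) = \int[mu]_x g x)%E.
Proof.
move=> [mT muT] mg g0.
have := @ge0_integral_pushforward _ _ X X R T mT mu setT g measurableT mg.
rewrite preimage_setT => <- //.
by apply: eq_measure_integral => A mA _; rewrite /= /pushforward muT.
Qed.

Lemma measure_preserving_iter d (X : measurableType d) (R : realType)
    (mu : probability X R) (T : X -> X) (n : nat) :
  measure_preserving mu T -> measure_preserving mu (iter n T).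
Proof.
move=> [mT muT]; split; first exact: measurable_iter.
elim: n => [//|n IH] A mA.
rewrite -[RHS]muT// -[RHS]IH//.
by rewrite -[X in measurable X]setTI; exact: mT.
Qed.

Lemma integrable_measure_preserving d (X : measurableType d) (R : realType)
    (mu : probability X R) (T : X -> X) (g : X -> \bar R) :
  measure_preserving mu T -> mu.-integrable setT g ->
  mu.-integrable setT (g \o T).
Proof.
move=> mp /integrableP[mg ig]; apply/integrableP; split.
  by apply: measurableT_comp => //; have [] := mp.
rewrite (@ge0_integral_measure_preserving _ _ _ mu T (fun x => `|g x|%E))//.
exact: measurableT_comp.
Qed.

Lemma integral_measure_preserving d (X : measurableType d) (R : realType)
    (mu : probability X R) (T : X -> X) (g : X -> \bar R) :
  measure_preserving mu T -> measurable_fun setT g ->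
  (\int[mu]_x g (T x) = \int[mu]_x g x)%E.
Proof.
move=> mp mg; rewrite integralE [RHS]integralE; congr (_ - _)%E.
- rewrite -(ge0_integral_measure_preserving mp (measurable_funepos mg))//.
  by apply: eq_integral => x _; rewrite !funeposE.
- rewrite -(ge0_integral_measure_preserving mp (measurable_funeneg mg))//.
  by apply: eq_integral => x _; rewrite !funenegE.
Qed.

(* The maximum of the ergodic sums of lengths [0] to [N], in the recursive form
   on which the maximal inequality rests. *)
Fixpoint maximal_sum (X : Type) (R : realType) (T : X -> X) (h : X -> R)
    (N : nat) (x : X) : R :=
  if N is N'.+1 then Num.max 0 (h x + maximal_sum T h N' (T x)) else 0.

Definition ergodic_sum (X : Type) (R : realType) (T : X -> X) (h : X -> R)
  (n : nat) (x : X) : R := \sum_(i < n) h (iter i T x).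

Lemma ergodic_sumS (X : Type) (R : realType) (T : X -> X) (h : X -> R) n x :
  ergodic_sum T h n.+1 x = h x + ergodic_sum T h n (T x).
Proof.
rewrite /ergodic_sum big_ord_recl/=; congr (_ + _).
by apply: eq_bigr => i _; rewrite -iterSr.
Qed.

Lemma maximal_sum_ge0 (X : Type) (R : realType) (T : X -> X) (h : X -> R) N x :
  0 <= maximal_sum T h N x.
Proof. by case: N => [|N] //=; rewrite le_max lexx. Qed.

Lemma maximal_sum_leS (X : Type) (R : realType) (T : X -> X) (h : X -> R) N x :
  maximal_sum T h N x <= maximal_sum T h N.+1 x.
Proof.
elim: N x => [|N IH] x; first exact: maximal_sum_ge0.
by rewrite /= ge_max le_max lexx/= le_max lerD2l IH orbT.
Qed.

Lemma maximal_sum_le (X : Type) (R : realType) (T : X -> X) (h : X -> R) m n x :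
  (m <= n)%N -> maximal_sum T h m x <= maximal_sum T h n x.
Proof.
move/subnK <-; elim: (n - m)%N => [//|k IH].
by rewrite addSn (le_trans IH)// maximal_sum_leS.
Qed.

Lemma ergodic_sum_le_maximal (X : Type) (R : realType) (T : X -> X) (h : X -> R) N x :
  ergodic_sum T h N x <= maximal_sum T h N x.
Proof.
elim: N x => [|N IH] x; first by rewrite /ergodic_sum big_ord0.
by rewrite ergodic_sumS/= le_max lerD2l IH orbT.
Qed.

Lemma integrable_maximal_sum d (X : measurableType d) (R : realType)
    (mu : probability X R) (T : X -> X) (h : X -> R) N :
  measure_preserving mu T -> mu.-integrable setT (EFin \o h) ->
  mu.-integrable setT (EFin \o maximal_sum T h N).
Proof.
move=> mp ih; elim: N => [|N IH]; first exact: integrable0.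
have := integrable_funepos measurableT
  (integrableD measurableT ih (integrable_measure_preserving mp IH)).
apply: eq_integrable => // x _.
by rewrite funeposE /= -EFinD -EFin_max maxC.
Qed.

Lemma integrable_indicM d (X : measurableType d) (R : realType)
    (mu : measure X R) (h : X -> R) (A : set X) :
  mu.-integrable setT (EFin \o h) -> measurable A ->
  mu.-integrable setT (EFin \o (fun x => h x * \1_A x)).
Proof.
move=> ih mA; apply: (le_integrable measurableT _ _ ih) => //.
  apply/measurable_EFinP; apply: measurable_funM => //.
  by apply/measurable_EFinP; have /integrableP[] := ih.
move=> x _ /=; rewrite lee_fin normrM ler_piMr// indicE.
by case: (_ \in _); rewrite ?normr1 ?normr0.
Qed.

(* With [M_N] the maximal sum, [h >= M_N - M_N \o T] where [M_N > 0], and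
   [M_N - M_N \o T <= 0] elsewhere; the right-hand side has integral [0]. *)
Lemma maximal_ergodic d (X : measurableType d) (R : realType)
    (mu : probability X R) (T : X -> X) (h : X -> R) :
  measure_preserving mu T -> mu.-integrable setT (EFin \o h) ->
  (forall x, h x != 0 -> exists n, 0 < ergodic_sum T h n x) ->
  (0 <= \int[mu]_x (h x)%:E)%E.
Proof.
move=> mp ih hS; pose E N := [set x | 0 < maximal_sum T h N x].
have iM N := integrable_maximal_sum N mp ih.
have mM N : measurable_fun setT (maximal_sum T h N).
  by apply/measurable_EFinP; have /integrableP[] := iM N.
have mE N : measurable (E N).
  rewrite /E -[X in measurable X]setTI.
  have -> : [set x | 0 < maximal_sum T h N x] = maximal_sum T h N @^-1` `]0, +oo[%classic.
    by apply/seteqP; split => x /=; rewrite in_itv/= andbT.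
  exact: mM.
pose hE N x := h x * \1_(E N) x.
have ihE N : mu.-integrable setT (EFin \o hE N).
  exact: integrable_indicM.
have hE0 N : (0 <= \int[mu]_x (hE N x)%:E)%E.
  case: N => [|N].
    by rewrite integral_ge0// => x _; rewrite lee_fin /hE indicE /E/= memNset ?mulr0//= ltxx.
  have iT := integrable_measure_preserving mp (iM N.+1).
  have <- : (\int[mu]_x ((EFin \o maximal_sum T h N.+1) x -
      ((EFin \o maximal_sum T h N.+1) \o T) x) = 0)%E.
    rewrite integralB// (_ : \int[mu]_x ((EFin \o maximal_sum T h N.+1) \o T) x =
        \int[mu]_x (EFin \o maximal_sum T h N.+1) x)%E.
      by apply: subee; exact: integrable_fin_num.
    apply: (@integral_measure_preserving _ _ _ mu T (EFin \o maximal_sum T h N.+1)) => //.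
    exact/measurable_EFinP.
  apply: le_integral => //.
  - exact: integrableB.
  - exact: ihE.
  move=> x _; rewrite /= -EFinB lee_fin /hE indicE.
  have [xE|xE] := boolP (x \in E N.+1).
    rewrite mulr1 lerBlDr; move: xE; rewrite inE /E/= => xE.
    move: (xE); rewrite lt_max ltxx/= => /ltW/max_idPr ->.
    rewrite lerD2l; exact: maximal_sum_leS.
  rewrite mulr0 subr_le0; move: xE; rewrite notin_setE /E/= => /negP.
  by rewrite -leNgt => /le_trans; apply; exact: (maximal_sum_ge0 T h N.+1).
(* Every point with [h x != 0] lies in [E N] for all large [N], so [hE N] tends to [h], dominated by
   its absolute value. *)
have cvg_hE x : (hE N x)%:E @[N --> \oo] --> (h x)%:E.
  have [hx|hx] := eqVneq (h x) 0.
    by rewrite /hE hx; under eq_fun do rewrite mul0r; exact: cvg_cst.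
  have [n nx] := hS x hx.
  apply: cvg_near_cst; exists n => // m /= nm; rewrite /hE indicE mem_set ?mulr1//=.
  by rewrite /E/= (lt_le_trans nx)// (le_trans (ergodic_sum_le_maximal _ _ _ _))// maximal_sum_le.
have dom x N : [set: X] x -> (`|(hE N x)%:E| <= `|(h x)%:E|)%E.
  by move=> _; rewrite lee_fin /hE normrM ler_piMr// indicE; case: (_ \in _); rewrite ?normr1 ?normr0.
have [_ _ hcvg] := @dominated_convergence _ _ _ mu setT measurableT
  (fun N x => (hE N x)%:E) (EFin \o h) (fun x => `|(h x)%:E|%E)
  (fun N => measurable_int _ (ihE N)) (measurable_int _ ih)
  (aeW mu (fun x _ => cvg_hE x)) (integrable_abse ih) (aeW mu dom).
rewrite -(cvg_lim _ hcvg)//.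
apply: lime_ge; last by apply: nearW => N; exact: hE0.
by apply/cvg_ex; eexists; exact: hcvg.
Qed.

(* [limsup u n / n > b], including the case of an infinite limsup. *)
Definition often_above (R : realType) (u : nat -> R) (b : R) : Prop :=
  exists j : nat, forall m, exists2 n, (m <= n)%N & n%:R * (b + j.+1%:R^-1) < u n.

Lemma often_above_le (R : realType) (u : nat -> R) (b b' : R) :
  b' <= b -> often_above u b -> often_above u b'.
Proof.
move=> bb [j hj]; exists j => m; have [n mn h] := hj m; exists n => //.
by apply: le_lt_trans h; rewrite ler_wpM2l// lerD2r.
Qed.

(** Applied to the ergodic sums at [x] and at [T x], this makes the level sets invariant. The shift
    and the constant [c] cause a bounded error, which half of the margin [n%:R * j.+1%:R^-1]
    eventually exceeds. *)
Lemma often_above_shift (R : realType) (u v : nat -> R) (c b : R) :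
  (forall n, u n.+1 = c + v n) -> often_above u b <-> often_above v b.
Proof.
move=> uv.
have half (j : nat) : (j.*2.+2)%:R^-1 = j.+1%:R^-1 / 2 :> R.
  by rewrite -doubleS -muln2 natrM invfM.
have arch (j : nat) (C : R) : exists K : nat, forall n : nat, (K <= n)%N -> C <= n%:R * (j.+1%:R^-1 / 2).
  exists (Num.truncn (`|C| * (2 * j.+1%:R))).+1 => n Kn.
  rewrite -ler_pdivrMr ?divr_gt0 ?invr_gt0//.
  have := truncn_itv (mulr_ge0 (normr_ge0 C) (mulr_ge0 (ler0n R 2) (ler0n R j.+1))).
  move=> /andP[_ /ltW h]; apply: le_trans (_ : `|C| * (2 * j.+1%:R) <= _).
    by rewrite invf_div invrK ler_wpM2r ?mulr_ge0// ler_norm.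
  by rewrite (le_trans h)// ler_nat.
split=> -[j hj]; exists j.*2.+1 => m.
- have [K hK] := arch j (`|c| + `|b|).
  have [[|n] mn h] := hj (maxn m K).+1; first by move: mn; rewrite ltn0.
  exists n; first by rewrite (leq_trans (leq_maxl m K)).
  have {}hK := hK n (leq_trans (leq_maxr m K) mn).
  rewrite half; move: h hK; rewrite uv -[n.+1%:R]natr1.
  have := ler_norm c; have := ler_norm (- b); rewrite normrN.
  have : 0 < (j.+1%:R^-1 : R) by rewrite invr_gt0.
  move: (j.+1%:R^-1 : R) (n%:R : R) => d x d0 hb hc h1 h2.
  rewrite mulrDl mul1r !mulrDr in h1 *; lra.
- have [K hK] := arch j (`|c| + `|b| + 1).
  have [n mn h] := hj (maxn m K).
  exists n.+1; first by rewrite (leq_trans (leq_maxl m K))// ltnW.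
  have {}hK := hK n (leq_trans (leq_maxr m K) mn).
  rewrite half; move: h hK; rewrite uv -[n.+1%:R]natr1.
  have := ler_norm (- c); have := ler_norm b; rewrite normrN.
  have : 0 < (j.+1%:R^-1 : R) by rewrite invr_gt0.
  have : (j.+1%:R^-1 : R) <= 1 by rewrite invf_le1// ler1n.
  move: (j.+1%:R^-1 : R) (n%:R : R) => d x d1 d0 hb hc h1 h2.
  rewrite mulrDl mul1r !mulrDr in h1 *; lra.
Qed.

(** The limit is the supremum of the [b] with [often_above u b], that is, the limsup of [u n / n].
    Testing oscillation on rational pairs leaves only countably many exceptional sets in
    [birkhoff]. *)
Lemma cvg_not_often_above (R : realType) (u : nat -> R) :
  (exists b, ~ often_above u b) -> (exists b, ~ often_above (fun n => - u n) b) ->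
  (forall a b : rat, (a < b)%R ->
    ~ (often_above u (ratr b) /\ often_above (fun n => - u n) (- ratr a))) ->
  cvgn (fun n => n%:R^-1 * u n).
Proof.
move=> [b1 hb1] [b2 hb2] hab.
have small (e : R) : 0 < e -> exists j : nat, j.+1%:R^-1 < e.
  move=> e0; exists (Num.truncn e^-1).
  rewrite invf_plt ?posrE//.
  have ei : 0 <= e^-1 by rewrite invr_ge0 ltW.
  by have /andP[] := truncn_itv ei.
have eventually_le (v : nat -> R) b c : b < c -> ~ often_above v b ->
    exists m, forall n, (m <= n)%N -> v n <= n%:R * c.
  move=> bc hv; have [j hj] := small (c - b) ltac:(by rewrite subr_gt0).
  apply: contrapT => h; apply: hv; exists j => m; apply: contrapT => h2; apply: h.
  exists m => n mn; rewrite leNgt; apply/negP => h3; apply: h2; exists n => //.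
  apply: le_lt_trans h3; rewrite ler_wpM2l//.
  by rewrite -lerBrDl ltW.
pose E := [set b | often_above u b].
have E0 : E !=set0.
  have [m hm] := @eventually_le _ b2 (b2 + 1) ltac:(lra) hb2.
  exists (- b2 - 3); exists 0%N => k; exists (maxn m k).+1.
    by rewrite (leq_trans (leq_maxr m k)).
  have := hm (maxn m k).+1 (leq_trans (leq_maxl m k) (leqnSn _)).
  have : (0 : R) < (maxn m k).+1%:R by rewrite ltr0n.
  move: (_%:R : R) (u _) => x y x0 h; rewrite invr1; nra.
have Eb : ubound E b1.
  by move=> b hb; rewrite leNgt; apply/negP => /ltW bb; apply: hb1; exact: often_above_le hb.
have hsE : has_sup E by split => //; exists b1.
apply/cvg_ex; exists (sup E); apply/cvgrPdist_le => e e0.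
have [|m1 hm1] := @eventually_le u (sup E + e / 2) (sup E + e) ltac:(lra).
  move=> h; have := ub_le_sup hsE.2 h; lra.
(* If [u n] fell below [n%:R * (sup E - e)] infinitely often, rationals [p < q] between [sup E - e]
   and [sup E - e / 2] would be crossed. *)
have [m2 hm2] : exists m, forall n, (m <= n)%N -> n%:R * (sup E - e) <= u n.
  apply: contrapT => h.
  have [b Ebb hb] := @sup_adherent _ E (e / 2) ltac:(lra) hsE.
  have [p] := @rat_in_itvoo _ (sup E - e) (sup E - e / 2) ltac:(lra).
  rewrite in_itv/= => /andP[p1 p2].
  have [q] := @rat_in_itvoo _ (ratr p) (sup E - e / 2) p2.
  rewrite in_itv/= => /andP[q1 q2].
  apply: (hab p q); first by rewrite -(@ltr_rat R).
  split; first by apply: often_above_le Ebb; lra.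
  have [j hj] := small (ratr p - (sup E - e)) ltac:(lra).
  exists j => m; apply: contrapT => h2; apply: h; exists m => n mn.
  rewrite leNgt; apply/negP => h3; apply: h2; exists n => //.
  rewrite ltrNr; apply: lt_le_trans h3 _; rewrite -mulrN ler_wpM2l//.
  by rewrite opprD opprK; move: hj; move: (_^-1) => z hj; lra.
exists (maxn m1 m2).+1 => // n /= hn.
have n0 : (0 : R) < n%:R by rewrite ltr0n (leq_trans _ hn).
have {}hm1 := hm1 n (leq_trans (leq_maxl m1 m2) (ltnW hn)).
have {}hm2 := hm2 n (leq_trans (leq_maxr m1 m2) (ltnW hn)).
rewrite ler_norml; apply/andP; split.
  rewrite lerBrDl -lerBrDr opprK mulrC ler_pdivrMr// mulrC; lra.
rewrite lerBlDr -lerBlDl [n%:R^-1 * _]mulrC ler_pdivlMr// mulrC; lra.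
Qed.

Lemma measurable_ergodic_sum d (X : measurableType d) (R : realType)
    (T : X -> X) (f : X -> R) n : measurable_fun setT T -> measurable_fun setT f ->
  measurable_fun setT (ergodic_sum T f n).
Proof.
move=> mT mf; apply: measurable_sum => i.
by apply: measurableT_comp => //; exact: measurable_iter.
Qed.

Lemma measurable_often_above d (X : measurableType d) (R : realType)
    (u : nat -> X -> R) (b : R) : (forall n, measurable_fun setT (u n)) ->
  measurable [set x | often_above (u ^~ x) b].
Proof.
move=> mu.
have -> : [set x | often_above (u ^~ x) b] = \bigcup_j \bigcap_m \bigcup_(n >= m)
    (u n @^-1` `]n%:R * (b + j.+1%:R^-1), +oo[%classic).
  apply/seteqP; split=> x.
    move=> [j hj]; exists j => // m _; have [n mn h] := hj m.
    by exists n => //=; rewrite in_itv/= h.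
  move=> [j _ hj]; exists j => m; have [n /= mn] := hj m I.
  by rewrite in_itv/= andbT => h; exists n.
apply: bigcup_measurable => j _; apply: bigcap_measurable => // m _.
apply: bigcup_measurable => n _; rewrite -[X in measurable X]setTI.
exact: mu.
Qed.

(** The maximal inequality is applied to [(f - b) * \1_A]: as [A] is invariant, its ergodic sums are
    those of [f - b] times [\1_A], and one of them is positive at each point of [A]. *)
Lemma invariant_level_set d (X : measurableType d) (R : realType)
    (mu : probability X R) (T : X -> X) (f : X -> R) (A : set X) (b : R) :
  measure_preserving mu T -> mu.-integrable setT (EFin \o f) -> measurable A ->
  (forall x, A (T x) <-> A x) -> (forall x, A x -> often_above (fun n => ergodic_sum T f n x) b) ->
  b * fine (mu A) <= fine (\int[mu]_x (f x * \1_A x)%:E).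
Proof.
move=> mp ih mA invA hA.
have icst (c : R) : mu.-integrable setT (EFin \o cst c).
  by apply: finite_measure_integrable_cst.
have iAf := integrable_indicM ih mA.
have iAb := integrable_indicM (icst b) mA.
pose h x := (f x - b) * \1_A x.
have hE x : (h x)%:E = ((f x * \1_A x)%:E - (b * \1_A x)%:E)%E by rewrite -EFinB -mulrBl.
have ihh : mu.-integrable setT (EFin \o h).
  have := integrableB measurableT iAf iAb.
  by apply: eq_integrable => // x _; rewrite /= hE.
have AT n x : A (iter n T x) <-> A x by elim: n => //= n IH; rewrite invA.
have Sh n x : ergodic_sum T h n x = \1_A x * (ergodic_sum T f n x - n%:R * b).
  rewrite /ergodic_sum /h.
  have iA i : \1_A (iter i T x) = \1_A x :> R.
    rewrite !indicE; congr (_%:R); congr nat_of_bool.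
    by apply/idP/idP; rewrite !inE AT.
  under eq_bigr do rewrite iA mulrC.
  by rewrite -mulr_sumr sumrB sumr_const card_ord mulr_natl.
have : (0 <= \int[mu]_x (h x)%:E)%E.
  apply: (maximal_ergodic mp ihh) => x; rewrite /h indicE.
  have [xA _|] := boolP (x \in A); last by rewrite mulr0 eqxx.
  rewrite inE in xA; have [j hj] := hA x xA; have [n n0 hn] := hj 1%N.
  exists n; rewrite Sh indicE mem_set// mul1r subr_gt0.
  apply: le_lt_trans hn; rewrite ler_wpM2l//.
  by rewrite lerDl invr_ge0.
under eq_integral do rewrite hE.
rewrite (integralB measurableT iAf iAb).
have -> : (\int[mu]_x (b * \1_A x)%:E = (b * fine (mu A))%:E)%E.
  under eq_integral do rewrite EFinM.
  rewrite integralZl//; last exact: integrable_indic.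
  rewrite integral_indic// setIT EFinM fineK//.
  exact: fin_num_measure.
rewrite sube_ge0; last by [].
by move=> hle; rewrite -lee_fin fineK//; exact: integrable_fin_num iAf.
Qed.

(** On the invariant set [A] where the limsup exceeds [b] and the liminf is below [a < b], the
    integral of [f] is at least [b * mu A] and at most [a * mu A], so [mu A = 0]. Infinite limits
    are excluded in the same way, by letting the level grow. *)
Lemma birkhoff d (X : measurableType d) (R : realType)
    (mu : probability X R) (T : X -> X) (f : X -> R) :
  measure_preserving mu T -> mu.-integrable setT (EFin \o f) ->
  {ae mu, forall x, cvgn (fun n => n%:R^-1 * ergodic_sum T f n x)}.
Proof.
move=> mp ih.
pose g x := - f x.
have ig : mu.-integrable setT (EFin \o g).
  by have := integrableN ih; apply: eq_integrable => // x _; rewrite /= EFinN.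
have gS n x : ergodic_sum T g n x = - ergodic_sum T f n x by rewrite /ergodic_sum sumrN.
pose Up (h : X -> R) (b : R) := [set x | often_above (fun n => ergodic_sum T h n x) b].
have mUp h b : mu.-integrable setT (EFin \o h) -> measurable (Up h b).
  move=> ihh; apply: measurable_often_above => n; apply: measurable_ergodic_sum.
    by have [] := mp.
  by apply/measurable_EFinP; have /integrableP[] := ihh.
have invUp h b x : Up h b (T x) <-> Up h b x.
  by rewrite /Up/= (often_above_shift (c := h x) (u := fun n => ergodic_sum T h n x)
    (v := fun n => ergodic_sum T h n (T x)))// => n; exact: ergodic_sumS.
have mu0 A : measurable A -> fine (mu A) <= 0 -> mu.-negligible A.
  move=> mA h; apply/negligibleP => //.
  have e0 : fine (mu A) = 0 by apply/eqP; rewrite eq_le h fine_ge0.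
  by have := fineK (fin_num_measure mu A mA); rewrite e0 => <-.
have Ig A : measurable A ->
    fine (\int[mu]_x (g x * \1_A x)%:E) = - fine (\int[mu]_x (f x * \1_A x)%:E).
  move=> mA; have iA := integrable_indicM ih mA.
  rewrite -fineN -[in RHS]mulN1e -integralZl//.
  by congr fine; apply: eq_integral => x _; rewrite -EFinM mulN1r mulNr.
have crossing (a b : rat) : (a < b)%R ->
    mu.-negligible (Up f (ratr b) `&` Up g (- ratr a)).
  move=> ab; set A := _ `&` _.
  have mA : measurable A by apply: measurableI; exact: mUp.
  have invA x : A (T x) <-> A x.
    by split=> -[h1 h2]; split; apply/invUp.
  have h1 := invariant_level_set mp ih mA invA (fun x h => h.1).
  have h2 := invariant_level_set mp ig mA invA (fun x h => h.2).
  rewrite Ig// in h2; apply: mu0 => //.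
  have : (ratr a : R) < ratr b by rewrite ltr_rat.
  nra.
have unbounded h : mu.-integrable setT (EFin \o h) ->
    mu.-negligible (\bigcap_(m : nat) Up h m%:R).
  move=> ihh; set A := \bigcap_m _.
  have mA : measurable A by apply: bigcap_measurable => // m _; exact: mUp.
  have invA x : A (T x) <-> A x.
    by split => hA m mI; apply/invUp; exact: hA.
  have lev m := invariant_level_set mp ihh mA invA (fun x hA => hA m I).
  apply: mu0 => //; rewrite leNgt; apply/negP => A0.
  move: lev; set J := fine (\int[mu]_x _) => lev.
  have := lev (Num.truncn (`|J| / fine (mu A))).+1.
  apply/negP; rewrite -ltNge -ltr_pdivrMr//.
  apply: le_lt_trans (_ : `|J| / fine (mu A) < _).
    by rewrite ler_pM2r ?invr_gt0// ler_norm.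
  have J0 : 0 <= `|J| / fine (mu A) by rewrite divr_ge0// ltW.
  by have /andP[] := truncn_itv J0.
have aeN A : mu.-negligible A -> {ae mu, forall x, ~ A x}.
  by move=> nA; apply: negligibleS nA => x /= /contrapT.
have F := ae_filter_ringOfSetsType mu.
have aeC : {ae mu, forall x, forall (k : nat) (a b : rat), unpickle k = Some (a, b) ->
    (a < b)%R -> ~ (Up f (ratr b) `&` Up g (- ratr a)) x}.
  apply: ae_foralln => k; case: (unpickle k) => [[a b]|]; last exact: aeW.
  have [ab|ab] := boolP (a < b)%R; last first.
    by apply: aeW => x a' b' [<- <-]; rewrite (negbTE ab).
  by apply: filterS (aeN _ (crossing _ _ ab)) => x h a' b' [<- <-] _.
apply: filterS (filterI aeC (filterI (aeN _ (unbounded f ih)) (aeN _ (unbounded g ig)))).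
move=> x [hC [hf hg]].
apply: cvg_not_often_above.
- apply: contrapT => h; apply: hf => m _; apply: contrapT => hm.
  by apply: h; exists m%:R.
- apply: contrapT => h; apply: hg => m _; apply: contrapT => hm.
  apply: h; exists m%:R; move: hm; rewrite /Up/=.
  by under [in X in X -> _]eq_fun do rewrite gS.
- move=> a b ab [h1 h2]; have := hC _ a b (pickleK (a, b)) ab.
  apply; split; first exact: h1.
  rewrite /Up/=.
  by have -> : (fun n => ergodic_sum T g n x) = (fun n => - ergodic_sum T f n x) by apply/funext => n.
Qed.

(* Averaging over [N] translates along the orbit turns the [L^2] bound into the
   pointwise correlation bound for the sequences [m |-> f (T ^ m x)]. *)
Lemma transference d (X : measurableType d) (R : realType)
    (mu : probability X R) (T : X -> X) (f : X -> R) (N : nat) (c : nat -> R) (A : R) :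
  measure_preserving mu T -> measurable_fun setT f ->
  (forall g : nat -> R, \sum_(j < N) (\sum_(n < N) c n * g (n + j)%N) ^+ 2 <=
    A * \sum_(m < 2 * N) g m ^+ 2) ->
  (0 < N)%N -> 0 <= A ->
  (\int[mu]_x ((\sum_(n < N) c n * f (iter n T x)) ^+ 2)%:E <=
    (2 * A)%:E * \int[mu]_x (f x ^+ 2)%:E)%E.
Proof.
move=> mp mf hA N0 A0.
pose h x := (\sum_(n < N) c n * f (iter n T x)) ^+ 2.
have mfi n : measurable_fun setT (fun x => f (iter n T x)).
  by apply: measurableT_comp => //; apply: measurable_iter; have [] := mp.
have mh : measurable_fun setT h.
  apply: measurable_funX; apply: measurable_sum => n.
  by apply: measurable_funM.
have shift (p : X -> R) n : measurable_fun setT p -> (forall x, 0 <= p x) ->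
    (\int[mu]_x (p (iter n T x))%:E = \int[mu]_x (p x)%:E)%E.
  move=> mp' p0; apply: (@ge0_integral_measure_preserving _ _ _ mu (iter n T) (EFin \o p)).
  - exact: measure_preserving_iter.
  - exact/measurable_EFinP.
  - by move=> x /=; rewrite lee_fin.
have mhn n : measurable_fun setT (fun x => (h (iter n T x))%:E).
  apply/measurable_EFinP; apply: (measurableT_comp mh).
  by apply: measurable_iter; have [] := mp.
have mfn n : measurable_fun setT (fun x => (f (iter n T x) ^+ 2)%:E).
  by apply/measurable_EFinP; apply: measurable_funX.
set I2 := (\int[mu]_x (f x ^+ 2)%:E)%E.
have I20 : (0 <= I2)%E by apply: integral_ge0 => x _; rewrite lee_fin sqr_ge0.
have NR : (0 : R) < N%:R by rewrite ltr0n.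
have esum_cst n (y : \bar R) : (0 <= y)%E -> (\sum_(i < n) y = n%:R%:E * y)%E.
  move=> y0; elim: n => [|n IH]; first by rewrite big_ord0 mul0e.
  by rewrite big_ord_recr/= IH -natr1 EFinD ge0_muleDl ?lee_fin// mul1e.
rewrite -/h -(@lee_pmul2l _ N%:R%:E)//.
have -> : (N%:R%:E * \int[mu]_x (h x)%:E = \int[mu]_x (\sum_(j < N) (h (iter j T x))%:E))%E.
  rewrite ge0_integral_sum//; last by move=> n x _; rewrite lee_fin sqr_ge0.
  rewrite (eq_bigr (fun=> \int[mu]_x (h x)%:E)%E) => [|j _].
    by rewrite esum_cst// integral_ge0// => x _; rewrite lee_fin sqr_ge0.
  by rewrite (shift h)// => x; exact: sqr_ge0.
(* The window of length [2 * N] contributes [2 * N] copies of [I2] against [N] copies on the left,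
   whence the factor 2. *)
have -> : (N%:R%:E * ((2 * A)%:E * I2) = A%:E * \int[mu]_x (\sum_(m < 2 * N) (f (iter m T x) ^+ 2)%:E))%E.
  rewrite ge0_integral_sum//; last by move=> n x _; rewrite lee_fin sqr_ge0.
  rewrite (eq_bigr (fun=> I2)) => [|j _].
    rewrite esum_cst// !muleA -!EFinM; congr (_%:E * _)%E.
    by rewrite natrM; ring.
  rewrite (shift (fun x => f x ^+ 2)) => [//||x]; last exact: sqr_ge0.
  exact: measurable_funX.
rewrite -ge0_integralZl//; last 2 first.
- exact: emeasurable_sum.
- by move=> x _; apply: sume_ge0 => i _; rewrite lee_fin sqr_ge0.
apply: ge0_le_integral => //.
- by move=> x _; apply: sume_ge0 => i _; rewrite lee_fin sqr_ge0.
- exact: emeasurable_sum.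
- by apply: emeasurable_funM => //; exact: emeasurable_sum.
- move=> x _; rewrite !sumEFin -EFinM lee_fin.
  apply: le_trans (hA (fun m => f (iter m T x))).
  by rewrite le_eqVlt; apply/orP; left; apply/eqP/eq_bigr => j _; rewrite /h;
    congr (_ ^+ 2); apply: eq_bigr => n _; rewrite iterD.
Qed.

(** * Averages along the hitting times *)

(** Summation by parts: the linear growth [e * n%:R] of the partial sums adds up to [e] times the
    total weight, so a Cesaro bound survives decreasing weights. *)
Lemma abel_sum_bound (R : realType) (w v : nat -> R) (C e : R) (N : nat) :
  (forall n, w n.+1 <= w n) -> (forall n, 0 <= w n) ->
  (forall n, `|\sum_(i < n) v i| <= C + e * n%:R) ->
  `|\sum_(i < N) w i * v i| <= C * w 0%N + e * \sum_(i < N) w i.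
Proof.
move=> wd w0 hS.
have C0 : 0 <= C by have := hS 0%N; rewrite mulr0 addr0; exact: le_trans.
case: N => [|N]; first by rewrite !big_ord0 normr0 mulr0 addr0 mulr_ge0.
have key : `|\sum_(i < N.+1) w i * v i - w N * \sum_(i < N.+1) v i| <=
    C * (w 0%N - w N) + e * (\sum_(i < N.+1) w i - N.+1%:R * w N).
  elim: N => [|N IH].
    by rewrite !big_ord_recr !big_ord0/= !add0r !subrr normr0 mul1r subrr !mulr0 addr0.
  have -> : \sum_(i < N.+2) w i * v i - w N.+1 * \sum_(i < N.+2) v i =
      (\sum_(i < N.+1) w i * v i - w N * \sum_(i < N.+1) v i) +
      (w N - w N.+1) * \sum_(i < N.+1) v i.
    by rewrite big_ord_recr [\sum_(i < N.+2) v i]big_ord_recr/=; ring.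
  have -> : C * (w 0%N - w N.+1) + e * (\sum_(i < N.+2) w i - N.+2%:R * w N.+1)
    = (C * (w 0%N - w N) + e * (\sum_(i < N.+1) w i - N.+1%:R * w N)) +
      (w N - w N.+1) * (C + e * N.+1%:R).
    by rewrite [\sum_(i < N.+2) w i]big_ord_recr/= -[N.+2]addn1 natrD; ring.
  apply: (le_trans (ler_normD _ _)); apply: lerD => //.
  by rewrite normrM ger0_norm ?subr_ge0// ler_wpM2l ?subr_ge0.
rewrite -[X in `|X|](subrK (w N * \sum_(i < N.+1) v i)).
apply: (le_trans (ler_normD _ _)); rewrite normrM (ger0_norm (w0 N)).
have := ler_wpM2l (w0 N) (hS N.+1).
move: key; set A := `|_ - _|; set B := w N * `|_|; set D := \sum_(i < N.+1) w i.
move=> h1 h2; apply: (le_trans (lerD h1 h2)).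
by rewrite le_eqVlt; apply/orP; left; apply/eqP; ring.
Qed.

Lemma weighted_cesaro (R : realType) (w u : nat -> R) (l : R) :
  (forall n, w n.+1 <= w n) -> (forall n, 0 <= w n) ->
  (\sum_(i < n) w i) @[n --> \oo] --> +oo ->
  (n%:R^-1 * \sum_(i < n) u i) @[n --> \oo] --> l ->
  ((\sum_(i < n) w i)^-1 * \sum_(i < n) w i * u i) @[n --> \oo] --> l.
Proof.
move=> wd w0 Winf Sl; apply/cvgrPdist_le => e e0.
have e2 : 0 < e / 2 by lra.
move/cvgrPdist_le : Sl => /(_ _ e2)[n0 _ n0P].
pose v i := u i - l.
have Sv n : \sum_(i < n) v i = \sum_(i < n) u i - n%:R * l.
  by rewrite /v sumrB sumr_const card_ord mulr_natl.
(* [C] absorbs the partial sums before [n0]; divergence of the total weight makes its contribution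
   negligible. *)
pose C := \sum_(m < n0) `|\sum_(i < m) v i|.
have C0 : 0 <= C by apply: sumr_ge0 => i _.
have hS n : `|\sum_(i < n) v i| <= C + e / 2 * n%:R.
  have [nn0|nn0] := ltnP n n0.
    rewrite /C (bigD1 (Ordinal nn0))//= -addrA lerDl addr_ge0//.
      by apply: sumr_ge0.
    by rewrite mulr_ge0// ltW.
  case: n => [|n] in nn0 *; first by rewrite big_ord0 normr0 mulr0 addr0.
  have := n0P n.+1 nn0; rewrite /= distrC => h.
  have -> : \sum_(i < n.+1) v i = n.+1%:R * (n.+1%:R^-1 * \sum_(i < n.+1) u i - l).
    by rewrite Sv mulrBr mulrA divff// mul1r.
  rewrite normrM ger0_norm// mulrC.
  apply: (@le_trans _ _ (e / 2 * n.+1%:R)); first by rewrite ler_pM2r.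
  by rewrite lerDr.
have [n1 _ n1P] : \forall n \near \oo, 1 + C * w 0%N / (e / 2) <= \sum_(i < n) w i.
  by move/cvgryPge : Winf; exact.
exists n1 => // n n1n; have WC := n1P n n1n.
have W0 : 0 < \sum_(i < n) w i.
  by apply: lt_le_trans WC; rewrite ltr_pwDl// divr_ge0 ?mulr_ge0// ltW.
have := abel_sum_bound n wd w0 hS.
have -> : \sum_(i < n) w i * v i = \sum_(i < n) w i * u i - (\sum_(i < n) w i) * l.
  by rewrite mulr_suml -sumrB; apply: eq_bigr => i _; rewrite mulrBr.
move: WC W0; set W := \sum_(i < n) w i; set U := \sum_(i < n) w i * u i => WC W0.
have : C * w 0%N <= e / 2 * W.
  rewrite -ler_pdivrMl// mulrC; apply: le_trans WC; lra.
move=> h1 h2; rewrite /= distrC.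
have -> : W^-1 * U - l = W^-1 * (U - W * l) by field; rewrite gt_eqF.
rewrite normrM gtr0_norm ?invr_gt0// mulrC ler_pdivrMr//; lra.
Qed.

(** For [N k <= n < N k.+1] monotonicity puts [P n / W n] between [P (N k) / W (N k.+1)] and
    [P (N k.+1) / W (N k)], which differ from terms of the convergent sequence by a factor tending
    to 1. *)
Lemma interpolate_cvg (R : realType) (P W : nat -> R) (l : R) (N : nat -> nat) :
  {homo P : m n / (m <= n)%N >-> m <= n} -> {homo W : m n / (m <= n)%N >-> m <= n} ->
  (forall n, 0 <= P n) -> (forall n, (0 < n)%N -> 0 < W n) ->
  {homo N : m n / (m < n)%N} -> N 0%N = 0%N ->
  (W (N k.+1) / W (N k)) @[k --> \oo] --> (1 : R) ->
  ((W (N k))^-1 * P (N k)) @[k --> \oo] --> l ->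
  ((W n)^-1 * P n) @[n --> \oo] --> l.
Proof.
move=> Pm Wm P0 W0 Nm N0 WN PN.
have NK n : exists k, (N k <= n < N k.+1)%N.
  elim: n => [|n [k /andP[h1 h2]]].
    by exists 0%N; rewrite N0 leqnn -[X in (X < _)%N]N0; apply: Nm.
  have [h3|h3] := ltnP n.+1 (N k.+1).
    by exists k; rewrite (leq_trans h1).
  by exists k.+1; rewrite h3 (leq_trans _ (Nm _ _ (ltnSn k.+1))).
pose kappa n := projT1 (cid (NK n)).
have kP n : (N (kappa n) <= n < N (kappa n).+1)%N by rewrite /kappa; case: cid.
have Nle : {homo N : m n / (m <= n)%N}.
  by move=> m n; rewrite leq_eqVlt => /predU1P[->//|/Nm/ltnW].
have kinf : kappa n @[n --> \oo] --> \oo.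
  apply/cvgnyPge => K; exists (N K) => // n /= NKn.
  rewrite leqNgt; apply/negP => kK.
  have /andP[_ h] := kP n.
  by have := leq_trans h (leq_trans (Nle _ _ kK) NKn); rewrite ltnn.
have kinf1 : (kappa n).+1 @[n --> \oo] --> \oo.
  apply: (@cvg_comp _ _ _ kappa S _ _ _ kinf).
  by have := cvg_addnr 1; under eq_fun do rewrite addn1.
pose lo n := (W (N (kappa n)))^-1 * P (N (kappa n)) / (W (N (kappa n).+1) / W (N (kappa n))).
pose hi n := (W (N (kappa n).+1))^-1 * P (N (kappa n).+1) * (W (N (kappa n).+1) / W (N (kappa n))).
have loc : lo n @[n --> \oo] --> l.
  rewrite -[l]mulr1 -[X in _ * X]invr1; apply: cvgM.
    exact: (cvg_comp _ _ kinf PN).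
  by apply: cvgV; [exact: oner_neq0|exact: (cvg_comp _ _ kinf WN)].
have hic : hi n @[n --> \oo] --> l.
  rewrite -[l]mulr1; apply: cvgM.
    exact: (cvg_comp _ _ kinf1 PN).
  exact: (cvg_comp _ _ kinf WN).
apply: squeeze_cvgr loc hic.
(* From [N 1] on the index [kappa n] is positive; at index 0 the denominator [W (N 0)] may
   vanish. *)
exists (N 1%N) => // n /= Nn.
have Npos k : (0 < k)%N -> (0 < N k)%N.
  by move=> k0; rewrite -[X in (X < _)%N]N0; apply: Nm.
have k0 : (0 < kappa n)%N.
  rewrite lt0n; apply/negP => /eqP k0; have /andP[_] := kP n.
  by rewrite k0 ltnNge Nn.
have /andP[h1 /ltnW h2] := kP n.
have n0 : (0 < n)%N by apply: leq_trans Nn; exact: Npos.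
have Wn := W0 _ n0; have W1 := Wm _ _ h1; have W2 := Wm _ _ h2.
have WNk := W0 _ (Npos _ k0); have WNk1 := W0 _ (Npos _ (ltn0Sn (kappa n))).
rewrite /lo /hi; apply/andP; split.
  rewrite [X in X <= _](_ : _ = (W (N (kappa n).+1))^-1 * P (N (kappa n))); last first.
    by field; rewrite !gt_eqF.
  by apply: ler_pM => //; [by rewrite invr_ge0 ltW|by rewrite lef_pV2 ?posrE|exact: Pm].
rewrite [X in _ <= X](_ : _ = (W (N (kappa n)))^-1 * P (N (kappa n).+1)); last first.
  by field; rewrite !gt_eqF.
by apply: ler_pM => //; [by rewrite invr_ge0 ltW// W0|by rewrite lef_pV2 ?posrE|exact: Pm].
Qed.

Lemma infinite_enumeration (h : pred nat) :
  (forall m, exists2 n, (m <= n)%N & h n) ->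
  exists t : nat -> nat, {homo t : m n / (m < n)%N} /\ range t = [set n | h n].
Proof.
move=> hinf.
have hex m : exists n, (m <= n)%N && h n by have [n mn hn] := hinf m; exists n; rewrite mn.
pose next m := ex_minn (hex m).
have nextP m : [/\ (m <= next m)%N, h (next m) &
    forall n, (m <= n)%N -> h n -> (next m <= n)%N].
  rewrite /next; case: ex_minnP => n /andP[mn hn] nmin; split => // n' mn' hn'.
  by apply: nmin; rewrite mn'.
pose t := fix t i := if i is j.+1 then next (t j).+1 else next 0%N.
have tS i : (t i < t i.+1)%N by have [] := nextP (t i).+1.
have tm : {homo t : m n / (m < n)%N} by apply: homo_ltn => //; exact: ltn_trans.
exists t; split => //; apply/seteqP; split => [_ [[|i] _ <-]|n /= hn].
- by have [] := nextP 0%N.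
- by have [] := nextP (t i).+1.
have ti i : (i <= t i)%N by elim: i => // i IH; exact: leq_ltn_trans (tS i).
have : (exists2 j, (j < n.+1)%N & t j = n) \/ (t n.+1 <= n)%N.
  elim: n.+1 => [|i [[j ji <-]|tin]].
  - by right; have [_ _] := nextP 0%N; exact.
  - by left; exists j => //; exact: ltnW.
  - move: tin; rewrite leq_eqVlt => /predU1P[<-|tin]; first by left; exists i.
    by right; have [_ _] := nextP (t i).+1; exact.
case=> [[j _ <-]|]; first by exists j.
by move/(leq_trans (ti n.+1)); rewrite ltnn.
Qed.

Lemma sum_enumeration (R : realType) (h : pred nat) (t : nat -> nat) (v : nat -> R) (m : nat) :
  {homo t : m n / (m < n)%N} -> range t = [set n | h n] ->
  \sum_(n < t m) (h n)%:R * v n = \sum_(i < m) v (t i).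
Proof.
move=> tm rt.
have ht i : h (t i) by have : range t (t i) by [exists i]; rewrite rt.
have th n : h n -> exists i, t i = n by move=> hn; have : [set n | h n] n by []; rewrite -rt => -[i _ <-]; exists i.
have tle i j : (i <= j)%N -> (t i <= t j)%N by rewrite leq_eqVlt => /predU1P[->|/tm/ltnW].
elim: m => [|m IH].
  rewrite big_ord0 big1// => n _; have [hn|] := boolP (h n); last by rewrite mul0r.
  by have [i ti] := th _ hn; have := ltn_ord n; rewrite -ti ltnNge tle.
rewrite big_ord_recr/= -IH -!(big_mkord xpredT (fun n => (h n)%:R * v n)).
rewrite (big_cat_nat (leq0n (t m)) (ltnW (tm _ _ (ltnSn m))))/=; congr (_ + _).
rewrite big_ltn ?tm// ht mul1r big_nat big1 ?addr0// => n /andP[n1 n2].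
have [hn|] := boolP (h n); last by rewrite mul0r.
have [i ti] := th _ hn; move: n1 n2; rewrite -ti.
have [im|mi] := leqP i m; first by rewrite ltnNge tle.
by move=> _; rewrite ltnNge tle.
Qed.

(** For nonincreasing [w] the ratio is at most that of the numbers of terms, a power of
    [1 + harmonic k] after a shift by one. *)
Lemma powers_ratio_cvg (R : realType) (w : nat -> R) (q : nat) : (0 < q)%N ->
  (forall m n, (m <= n)%N -> w n <= w m) -> (forall n, 0 < w n) ->
  (\sum_(i < k.+1 ^ q) w i) / (\sum_(i < k ^ q) w i) @[k --> \oo] --> (1 : R).
Proof.
move=> q0 wd w0; rewrite -cvg_shiftS/=.
pose W n := \sum_(i < n) w i.
have hcvg : (1 + harmonic k) ^+ q @[k --> \oo] --> (1 : R).
  elim: (q) => [|p IH]; first by under eq_fun do rewrite expr0; exact: cvg_cst.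
  have H : (1 + harmonic k : R) @[k --> \oo] --> (1 + 0 : R).
    by apply: cvgD; [exact: cvg_cst|exact: cvg_harmonic].
  have H2 := cvgM H IH; rewrite addr0 mulr1 in H2.
  by under eq_fun do rewrite exprS; exact: H2.
apply: squeeze_cvgr (cvg_cst (1 : R)) hcvg; apply: nearW => k.
set M := (k.+1 ^ q)%N; set M' := (k.+2 ^ q)%N.
have MM : (M <= M')%N by rewrite leq_exp2r.
have M0 : (0 < M)%N by rewrite expn_gt0.
have WM : M%:R * w M <= W M.
  have -> : M%:R * w M = \sum_(i < M) w M by rewrite sumr_const card_ord mulr_natl.
  by apply: ler_sum => i _; rewrite wd// ltnW.
have W0 : 0 < W M by apply: lt_le_trans WM; rewrite mulr_gt0 ?ltr0n.
have WE : W M' = W M + \sum_(M <= i < M') w i.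
  by rewrite /W -!(big_mkord xpredT) (big_cat_nat (leq0n M) MM).
have tail0 : 0 <= \sum_(M <= i < M') w i by apply: sumr_ge0 => i _; exact: ltW.
have tail : \sum_(M <= i < M') w i <= (M' - M)%N%:R * w M.
  rewrite mulr_natl -sumr_const_nat; apply: ler_sum_nat => i /andP[Mi _]; exact: wd.
rewrite -!/(W _) ler_pdivlMr// ler_pdivrMr// mul1r WE; apply/andP; split; first by rewrite lerDl.
have -> : (1 + harmonic k) ^+ q = M'%:R / M%:R :> R.
  rewrite /harmonic /M /M' !natrX -expr_div_n; congr (_ ^+ _).
  by rewrite -[k.+2%:R]natr1 mulrDl divff ?mul1r.
have MR : (0 : R) < M%:R by rewrite ltr0n.
rewrite mulrAC ler_pdivlMr//.
rewrite natrB// in tail.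
have MM' : (M%:R : R) <= M'%:R by rewrite ler_nat.
move: tail WM MM' W0 (w0 M) tail0; set S := \sum_(_ <= _ < _) _.
move: (W M) (M%:R : R) (M'%:R : R) (w M) MR => x y y' z y0 h1 h2 h3 h4 h5 h6.
have : 0 <= (y' - y) * (x - y * z) by rewrite mulr_ge0// subr_ge0.
have : 0 <= y * ((y' - y) * z - S) by rewrite mulr_ge0 ?subr_ge0// ltW.
lra.
Qed.

(** The case [v = 1] of [key] shows that the number of hits below [n] is asymptotic to [W n].
    Dividing the case [v = u] by it at [n = t m] replaces the normalisation [W] by the count [m]. *)
Lemma subsequence_average_cvg (R : realType) (w u : nat -> R) (h : pred nat) (q : nat) (t : nat -> nat) (l : R) :
  (0 < q)%N -> (forall m n, (m <= n)%N -> w n <= w m) -> (forall n, 0 < w n) ->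
  (\sum_(i < n) w i) @[n --> \oo] --> +oo ->
  {homo t : m n / (m < n)%N} -> range t = [set n | h n] ->
  (forall n, 0 <= u n) ->
  (n%:R^-1 * \sum_(i < n) u i) @[n --> \oo] --> l ->
  ((\sum_(n < k.+1 ^ q) w n)^-1 * \sum_(n < k.+1 ^ q) ((h n)%:R - w n)) @[k --> \oo] --> (0 : R) ->
  ((\sum_(n < k.+1 ^ q) w n)^-1 * \sum_(n < k.+1 ^ q) ((h n)%:R - w n) * u n) @[k --> \oo] --> (0 : R) ->
  (m%:R^-1 * \sum_(i < m) u (t i)) @[m --> \oo] --> l.
Proof.
move=> q0 wd w0 Winf tm rt u0 ul d1 du.
pose W n := \sum_(i < n) w i.
have key (v : nat -> R) (L : R) : (forall n, 0 <= v n) ->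
    (n%:R^-1 * \sum_(i < n) v i) @[n --> \oo] --> L ->
    ((W (k.+1 ^ q)%N)^-1 * \sum_(n < k.+1 ^ q) ((h n)%:R - w n) * v n) @[k --> \oo] --> (0 : R) ->
    ((W n)^-1 * \sum_(i < n) (h i)%:R * v i) @[n --> \oo] --> L.
  move=> v0 vL dv.
  have powinf : (k.+1 ^ q)%N @[k --> \oo] --> \oo.
    apply/cvgnyPge => K; exists K => // k /= Kk; apply: (leq_trans Kk).
    by rewrite -(prednK q0) expnS (leq_trans (leqnSn k))// leq_pmulr// expn_gt0.
  apply: (@interpolate_cvg R (fun n => \sum_(i < n) (h i)%:R * v i) W L (fun k => (k ^ q)%N)).
  - move=> m n mn; rewrite -!(big_mkord xpredT (fun i => (h i)%:R * v i)).
    by rewrite [leRHS](big_cat_nat (leq0n m) mn)/= lerDl sumr_ge0// => i _; rewrite mulr_ge0.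
  - move=> m n mn; rewrite /W -!(big_mkord xpredT w).
    by rewrite [leRHS](big_cat_nat (leq0n m) mn)/= lerDl sumr_ge0// => i _; exact: ltW.
  - by move=> n; apply: sumr_ge0 => i _; rewrite mulr_ge0.
  - move=> [//|n] _; rewrite /W big_ord_recr/= ltr_wpDl// sumr_ge0// => i _; exact: ltW.
  - by move=> m n mn; rewrite ltn_exp2r.
  - by rewrite exp0n.
  - exact: powers_ratio_cvg.
  - have := weighted_cesaro (fun n => wd _ _ (leqnSn n)) (fun n => ltW (w0 n)) Winf vL.
    move=> /(cvg_comp _ _ powinf) H.
    have H2 := cvgD dv H; rewrite add0r in H2.
    have E : (fun k => (W (k.+1 ^ q)%N)^-1 * \sum_(i < k.+1 ^ q) (h i)%:R * v i) =
        (fun k => (W (k.+1 ^ q)%N)^-1 * \sum_(n < k.+1 ^ q) ((h n)%:R - w n) * v n) \+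
        ((fun n => (\sum_(i < n) w i)^-1 * \sum_(i < n) w i * v i) \o (fun k => (k.+1 ^ q)%N)).
      apply/funext => k /=; rewrite -mulrDr; congr (_ * _).
      by rewrite -big_split/=; apply: eq_bigr => i _; ring.
    by rewrite -cvg_shiftS E; exact: H2.
have Pl := key u l u0 ul du.
have C1 : ((W n)^-1 * \sum_(i < n) (h i)%:R * 1) @[n --> \oo] --> (1 : R).
  apply: (key (fun=> 1)) => //; last by under eq_fun do under eq_bigr do rewrite mulr1; exact: d1.
  apply: cvg_near_cst; exists 1%N => // n /= n0.
  by rewrite sumr_const card_ord mulVf// pnatr_eq0 -lt0n.
have tinf : t m @[m --> \oo] --> \oo.
  apply/cvgnyPge => K; exists K => // k /= Kk; apply: (leq_trans Kk).
  by elim: k {Kk} => // k IH; exact: leq_ltn_trans (tm _ _ (ltnSn k)).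
have H := cvgM (cvgV (oner_neq0 R) (cvg_comp _ _ tinf C1)) (cvg_comp _ _ tinf Pl).
rewrite invr1 mul1r in H; apply: (cvg_trans _ (H _ _)); apply: near_eq_cvg.
exists 1%N => // m /= m0.
rewrite (sum_enumeration (fun=> 1) _ tm rt) (sum_enumeration u _ tm rt) sumr_const card_ord.
have tm0 : (0 < t m)%N.
  by case: m m0 => // m _; exact: leq_ltn_trans (tm _ _ (ltn0Sn m)).
have W0 : 0 < W (t m).
  case: (t m) tm0 => // n _; rewrite /W big_ord_recr/= ltr_wpDl// sumr_ge0// => i _; exact: ltW.
by field; rewrite gt_eqF ?gt_eqF ?ltr0n.
Qed.

(** The series of squares has finite integral, so it converges almost everywhere and its terms tend
    to 0. *)
Lemma ae_cvg0_integral_sqr d (X : measurableType d) (R : realType)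
    (mu : probability X R) (D : nat -> X -> R) (C : R) :
  (forall k, measurable_fun setT (D k)) ->
  (forall k, (\int[mu]_x (D k x ^+ 2)%:E <= (C * (k.+1%:R ^+ 2)^-1)%:E)%E) ->
  {ae mu, forall x, D k x @[k --> \oo] --> (0 : R)}.
Proof.
move=> mD hD.
have mD2 k : measurable_fun setT (fun x => (D k x ^+ 2)%:E).
  by apply/measurable_EFinP; exact: measurable_funX.
have D20 k x : (0 <= (D k x ^+ 2)%:E)%E by rewrite lee_fin sqr_ge0.
pose S x := (\sum_(k <oo) (D k x ^+ 2)%:E)%E.
have mS : measurable_fun setT S by exact: ge0_emeasurable_sum.
have S0 x : (0 <= S x)%E by exact: nneseries_ge0.
have iS : mu.-integrable setT S.
  apply/integrableP; split => //.
  under eq_integral do rewrite gee0_abs//.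
  rewrite /S integral_nneseries//.
  by apply: (nneseries_inv_sqr_lty _ hD) => k; exact: integral_ge0.
have F := ae_filter_ringOfSetsType mu.
apply: filterS (integrable_ae measurableT iS) => x /(_ I) Sx.
have Sx' : (\sum_(k <oo) (D k x ^+ 2)%:E < +oo)%E by rewrite ltey_eq Sx.
have /cvg_series_cvg_0 h := nnseries_is_cvg (fun k => sqr_ge0 (D k x)) Sx'.
apply/cvgrPdist_le => e e0.
have e20 : 0 < e ^+ 2 by rewrite exprn_gt0.
move/cvgrPdist_le : h => /(_ _ e20); apply: filterS => k /=.
rewrite !sub0r !normrN ger0_norm ?sqr_ge0// => h.
by rewrite -(@ler_pXn2r _ 2)// ?nnegrE ?(ltW e0)// real_normK ?num_real.
Qed.

Lemma cvg_sum_weight (R : realType) (a : R) : 0 < a -> a < 1 ->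
  (\sum_(i < n) weight a i) @[n --> \oo] --> +oo.
Proof.
move=> a0 a1; have a1' : 0 < 1 - a by rewrite subr_gt0.
apply/cvgryPge => A; pose K := `|A| `^ (1 - a)^-1.
exists (Num.truncn K).+1 => // n /= Kn.
have n0 : (0 < n)%N by apply: leq_trans Kn.
apply: le_trans (sum_weight_ge (ltW a0) n0).
apply: le_trans (ler_norm A) _.
have -> : `|A| = K `^ (1 - a) by rewrite -powRrM mulVf ?gt_eqF// powRr1.
have K0 : 0 <= K by exact: powR_ge0.
apply: ge0_ler_powR; rewrite ?nnegrE ?(ltW a1')//.
have /andP[_ /ltW h] := truncn_itv K0.
by rewrite (le_trans h)// ler_nat.
Qed.

(** Fixed by choice, so that the estimate on [y] and its use in every system refer to the same test
    weights. *)
Definition unit_weights (R : rcfType) (N : nat) : nat -> nat -> R :=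
  projT1 (cid (real_correlation_bound R N)).

Lemma unit_weightsP (R : rcfType) (N : nat) : let ws := unit_weights R N in
  [/\ forall n, ws 0%N n = 1, forall k n, `|ws k n| <= 1 &
    forall (c g : nat -> R) (A : R), 0 <= A ->
    (forall k, (k < 4 * N)%N -> `|\sum_(n < N) c n * ws k n| <= A) ->
    \sum_(j < N) (\sum_(n < N) c n * g (n + j)%N) ^+ 2 <=
    (2 * A) ^+ 2 * \sum_(m < 2 * N) g m ^+ 2].
Proof. by rewrite /unit_weights; case: cid. Qed.

Lemma ae_discrepancy_cvg0 d (X : measurableType d) (R : realType)
    (mu : probability X R) (T : X -> X) (f : X -> R) (q k0 : nat) (c : nat -> R)
    (W : nat -> R) (C : R) :
  measure_preserving mu T -> measurable_fun setT f ->
  mu.-integrable setT (EFin \o (fun x => f x ^+ 2)) ->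
  (forall k, 0 < W k) -> 0 <= C ->
  (forall k, (k0 <= k)%N -> forall j, (j < 4 * k.+1 ^ q)%N ->
    `|\sum_(n < k.+1 ^ q) c n * unit_weights R (k.+1 ^ q)%N j n| <= C * W k / k.+1%:R) ->
  {ae mu, forall x,
    ((W k)^-1 * \sum_(n < k.+1 ^ q) c n * f (iter n T x)) @[k --> \oo] --> (0 : R)}.
Proof.
move=> mp mf if2 W0 C0 hc.
(* The bound holds only from [k0] on; the shift makes it available at every index. *)
pose D k x := (W (k + k0)%N)^-1 * \sum_(n < (k + k0).+1 ^ q) c n * f (iter n T x).
pose I2 := fine (\int[mu]_x (f x ^+ 2)%:E).
have I2E : (\int[mu]_x (f x ^+ 2)%:E = I2%:E)%E.
  by rewrite /I2 fineK//; exact: (integrable_fin_num measurableT if2).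
have I20 : 0 <= I2 by apply: fine_ge0; apply: integral_ge0 => x _; rewrite lee_fin sqr_ge0.
have msum k : measurable_fun setT (fun x => \sum_(n < k.+1 ^ q) c n * f (iter n T x)).
  apply: measurable_sum => n; apply: measurable_funM => //.
  by apply: measurableT_comp => //; apply: measurable_iter; have [] := mp.
have mD k : measurable_fun setT (D k) by apply: measurable_funM.
have hD k : (\int[mu]_x (D k x ^+ 2)%:E <= (8 * C ^+ 2 * I2 * (k.+1%:R ^+ 2)^-1)%:E)%E.
  set j := (k + k0)%N; have jk : (k0 <= j)%N by rewrite leq_addl.
  set A := C * W j / j.+1%:R.
  have A0 : 0 <= A by rewrite /A !mulr_ge0 ?invr_ge0// ltW.
  have [_ _ H] := unit_weightsP R (j.+1 ^ q).
  have tr := transference mp mf (fun g => H c g A A0 (hc j jk)).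
  have {}tr := tr _ (sqr_ge0 _); rewrite expn_gt0 I2E in tr; have {}tr := tr isT.
  have -> : (\int[mu]_x (D k x ^+ 2)%:E = ((W j)^-1 ^+ 2)%:E *
      \int[mu]_x ((\sum_(n < j.+1 ^ q) c n * f (iter n T x)) ^+ 2)%:E)%E.
    rewrite -ge0_integralZl//.
    - by apply: eq_integral => x _; rewrite -EFinM -exprMn.
    - by apply/measurable_EFinP; exact: measurable_funX.
    - by move=> x _; rewrite lee_fin sqr_ge0.
    - by rewrite lee_fin sqr_ge0.
  apply: (@le_trans _ _ (((W j)^-1 ^+ 2)%:E * ((2 * (2 * A) ^+ 2)%:E * I2%:E))%E).
    by apply: lee_wpmul2l => //; rewrite lee_fin sqr_ge0.
  rewrite -!EFinM lee_fin.
  have Wn0 : W j != 0 by rewrite gt_eqF.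
  (* 8 is the factor 2 of [transference] times the square of the 2 in the correlation bound. *)
  have -> : (W j)^-1 ^+ 2 * (2 * (2 * A) ^+ 2 * I2) = 8 * C ^+ 2 * I2 * (j.+1%:R ^+ 2)^-1.
    have K0 : (j.+1%:R : R) != 0 by rewrite pnatr_eq0.
    by rewrite /A; move: (j.+1%:R : R) K0 => K K0; field; rewrite Wn0 K0.
  rewrite ler_wpM2l ?mulr_ge0 ?sqr_ge0//.
  by rewrite lef_pV2 ?posrE ?exprn_gt0// lerXn2r ?nnegrE// ler_nat ltnS leq_addr.
have F := ae_filter_ringOfSetsType mu.
apply: filterS (ae_cvg0_integral_sqr mD hD) => x.
by rewrite -(cvg_shiftn k0 (fun k => (W k)^-1 * \sum_(n < k.+1 ^ q) c n * f (iter n T x))).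
Qed.

(** The root of unity 1, that is, the constant weight of index 0, is among those tested. *)
Lemma mean_discrepancy_cvg0 (R : realType) (q k0 : nat) (c W : nat -> R) (C : R) :
  (0 < q)%N -> (forall k, 0 < W k) -> 
  (forall k, (k0 <= k)%N -> forall j, (j < 4 * k.+1 ^ q)%N ->
    `|\sum_(n < k.+1 ^ q) c n * unit_weights R (k.+1 ^ q)%N j n| <= C * W k / k.+1%:R) ->
  ((W k)^-1 * \sum_(n < k.+1 ^ q) c n) @[k --> \oo] --> (0 : R).
Proof.
move=> q0 W0 hc.
have h0 : (C * harmonic k) @[k --> \oo] --> (0 : R).
  by rewrite -(mulr0 C); apply: cvgM; [exact: cvg_cst|exact: cvg_harmonic].
apply/norm_cvg0P; apply: squeeze_cvgr (cvg_cst (0 : R)) h0.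
exists k0 => // k /= kk0; rewrite normr_ge0/= normrM gtr0_norm ?invr_gt0//.
have := hc k kk0 0%N; rewrite muln_gt0 expn_gt0 => /(_ isT).
have [w1 _ _] := unit_weightsP R (k.+1 ^ q).
rewrite [X in `|X| <= C * _ / _](eq_bigr (fun n : 'I_(k.+1 ^ q) => c n)) => [|n _].
  by rewrite ler_pdivrMl// mulrA [_ * C]mulrC.
by rewrite w1 mulr1.
Qed.

Lemma ae_subsequence_average d (X : measurableType d) (R : realType)
    (mu : probability X R) (T : X -> X) (f : X -> R) (q k0 : nat) (a : R)
    (h : pred nat) (t : nat -> nat) (C : R) :
  measure_preserving mu T -> measurable_fun setT f ->
  mu.-integrable setT (EFin \o f) ->
  mu.-integrable setT (EFin \o (fun x => f x ^+ 2)) ->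
  (forall x, 0 <= f x) -> 0 < a -> a < 1 -> (0 < q)%N -> 0 <= C ->
  {homo t : m n / (m < n)%N} -> range t = [set n | h n] ->
  (forall k, (k0 <= k)%N -> forall j, (j < 4 * k.+1 ^ q)%N ->
    `|\sum_(n < k.+1 ^ q) ((h n)%:R - weight a n) * unit_weights R (k.+1 ^ q)%N j n| <=
    C * (\sum_(n < k.+1 ^ q) weight a n) / k.+1%:R) ->
  {ae mu, forall x, cvgn (fun m => m%:R^-1 * \sum_(i < m) f (iter (t i).+1 T x))}.
Proof.
move=> mp mf if1 if2 f0 a0 a1 q0 C0 tm rt hc.
have mT : measurable_fun setT T by have [] := mp.
have W0 k : 0 < \sum_(n < k.+1 ^ q) weight a n.
  apply: lt_le_trans (sum_weight_ge (ltW a0) _); last by rewrite expn_gt0.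
  by rewrite powR_gt0// ltr0n expn_gt0.
have iF1 := integrable_measure_preserving mp if1.
have iF2 := integrable_measure_preserving mp if2.
have F := ae_filter_ringOfSetsType mu.
(* Index [n] stands for time [n.+1], hence [f \o T] in place of [f]. *)
apply: filterS (filterI (birkhoff (f := f \o T) mp iF1)
  (ae_discrepancy_cvg0 (f := f \o T) (c := fun n => (h n)%:R - weight a n) mp (measurableT_comp mf mT) iF2 W0 C0 hc)).
move=> x [/cvg_ex[l ul] du]; apply/cvg_ex; exists l.
apply: (@subsequence_average_cvg R (weight a) (fun n => f (iter n.+1 T x)) h q t l) => //.
- by move=> m n; exact/weight_nincr/ltW.
- exact: weight_gt0.
- exact: cvg_sum_weight.
- exact: (mean_discrepancy_cvg0 (c := fun n => (h n)%:R - weight a n) q0 W0 hc).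
Qed.

Theorem theoremA (R : realType) (a : R) (r : nat)
    (a_gt0 : 0 < a) (a_lt1 : a < 1) (r_ge2 : (2 <= r)%N) :
  {ae lebesgue_measure, forall y : R, 0 <= y <= 1 ->
    exists2 s : nat -> nat,
      increasing_enumeration (hitting_times a r y) s & pointwise_good (2 : R) s}.
Proof.
have ws1 N j n : `|unit_weights R N j n| <= 1 by have [] := unit_weightsP R N.
have [q [q0 [C C0 aeG]]] := ae_exponential_sums a_gt0 a_lt1 r_ge2 ws1.
have FL := ae_filter_ringOfSetsType (@lebesgue_measure R).
apply: (@filterS _ _ FL _ _ _ aeG) => y hy /hy[k0 hc] {hy}.
pose h n := `[< hitting_times a r y n.+1 >].
pose W k := \sum_(n < k.+1 ^ q) weight a n.
have W0 k : 0 < W k.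
  apply: lt_le_trans (sum_weight_ge (ltW a_gt0) _); last by rewrite expn_gt0.
  by rewrite powR_gt0// ltr0n expn_gt0.
(* If all hits came before [m], their number would stay at most [m]; but it is eventually at least
   half of [W k], and [W k] exceeds [2 * m]. *)
have hinf m : exists2 n, (m <= n)%N & h n.
  apply: contrapT => hm.
  have h0 n : (m <= n)%N -> h n = false.
    by move=> mn; apply/negP => hn; apply: hm; exists n.
  have hsum N : \sum_(n < N) (h n)%:R <= m%:R :> R.
    apply: (@le_trans _ _ (\sum_(n < maxn m N) (h n)%:R)).
      rewrite -!(big_mkord xpredT (fun n => (h n)%:R)).
      by rewrite [leRHS](big_cat_nat (leq0n N) (leq_maxr m N))/= lerDl sumr_ge0.
    rewrite -(big_mkord xpredT (fun n => (h n)%:R)).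
    rewrite (big_cat_nat (leq0n m) (leq_maxl m N))/= [X in _ + X]big_nat [X in _ + X]big1 => [|n /andP[mn _]].
      rewrite addr0 big_mkord -[X in X%:R]card_ord -sumr_const.
      by apply: ler_sum => n _; case: (h n).
    by rewrite h0.
  have e0 : (0 : R) < 2^-1 by rewrite invr_gt0.
  have /cvgrPdist_le/(_ _ e0)[k1 _ hk1] :=
    mean_discrepancy_cvg0 (c := fun n => (h n)%:R - weight a n) q0 W0 hc.
  have /cvgryPge/(_ (2 * m%:R + 1))[k2 _ hk2] := cvg_sum_weight a_gt0 a_lt1.
  have := hk1 (maxn k1 k2) (leq_maxl _ _); set k := maxn k1 k2.
  have {hk2} : 2 * m%:R + 1 <= W k.
    apply: hk2 => /=; apply: (leq_trans (leq_maxr k1 k2)).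
    by rewrite -(prednK q0) expnS (leq_trans (leqnSn k))// leq_pmulr// expn_gt0.
  have /= := hsum (k.+1 ^ q)%N; rewrite sub0r normrN sumrB -/(W k) mulrBr mulVf ?gt_eqF//.
  set Sh := \sum_(_ < _) _ => hS hW; rewrite ler_norml => /andP[+ _].
  rewrite lerBrDr mulrC ler_pdivlMr//; have := W0 k; lra.
have [t [tm rt]] := infinite_enumeration hinf.
exists (fun n => (t n).+1).
  split; first by move=> m n /tm; rewrite ltnS.
  apply/seteqP; split => [_ [n _ <-]|n].
    by have : range t (t n) by [exists n]; rewrite rt => /asboolP.
  case: n => [[]//|n] hn; have : [set n | h n] n by exact/asboolP.
  by rewrite -rt => -[i _ <-]; exists i.
move=> d X mu T mp f fL.
have mf : measurable_fun setT f by move: fL; rewrite inE => /andP[+ _]; rewrite inE.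
have if2 := Lfun2_integrable_sqr fL.
have if1 : mu.-integrable setT (EFin \o f).
  by apply/Lfun1_integrable; apply: Lfun_subset12 fL; exact: fin_num_measure.
(* Interpolation between scales needs nonnegative functions, so the positive parts of [f] and [- f]
   are treated separately. *)
have pos (g : X -> R) : measurable_fun setT g -> mu.-integrable setT (EFin \o g) ->
    mu.-integrable setT (EFin \o (fun x => g x ^+ 2)) ->
    {ae mu, forall x, cvgn (fun m => m%:R^-1 * \sum_(i < m) Num.max 0 (g (iter (t i).+1 T x)))}.
  move=> mg ig1 ig2.
  have mgp : measurable_fun setT (fun x => Num.max 0 (g x)).
    by apply: measurable_maxr => //; exact: measurable_cst.
  apply: (@ae_subsequence_average _ X R mu T (fun x => Num.max 0 (g x)) q k0 a h t C) => //.
  - apply: (le_integrable measurableT _ _ ig1); first exact/measurable_EFinP.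
    by move=> x _ /=; rewrite lee_fin ger0_norm ?le_max ?lexx// ge_max normr_ge0 ler_norm.
  - apply: (le_integrable measurableT _ _ ig2).
      by apply/measurable_EFinP; exact: measurable_funX.
    move=> x _ /=; rewrite lee_fin !normrX lerXn2r ?nnegrE//.
    by rewrite ger0_norm ?le_max ?lexx// ge_max normr_ge0 ler_norm.
  - by move=> x; rewrite le_max lexx.
have F := ae_filter_ringOfSetsType mu.
have ng1 : mu.-integrable setT (EFin \o (fun x => - f x)).
  by have := integrableN if1; apply: eq_integrable => // x _; rewrite /= EFinN.
have ng2 : mu.-integrable setT (EFin \o (fun x => (- f x) ^+ 2)).
  by apply: eq_integrable if2 => // x _; rewrite /= sqrrN.
have mnf : measurable_fun setT (fun x => - f x) by exact: measurable_funN.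
apply: filterS (filterI (pos f mf if1 if2) (pos _ mnf ng1 ng2)) => x [/= h1 h2].
have -> : (fun N => ergodic_average (fun n => (t n).+1) T f N x) =
    (fun m => m%:R^-1 * \sum_(i < m) Num.max 0 (f (iter (t i).+1 T x))) -
    (fun m => m%:R^-1 * \sum_(i < m) Num.max 0 (- f (iter (t i).+1 T x))).
  apply/funext => N; rewrite /ergodic_average fctE/= -mulrBr -sumrB; congr (_ * _).
  apply: eq_bigr => i _; set z := f _.
  by case: (leP 0 z) => z0; case: (leP 0 (- z)) => z1; lra.
exact: is_cvgB.
Qed.
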